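(* Every countable icc group $G$ admits a free, metrizable, proximal $G$-flow.
   Context: A group is icc if every non-identity element has an infinite conjugacy class. A $G$-flow is a compact Hausdorff space with an action of $G$ by homeomorphisms; it is free if every point has trivial stabilizer. A $G$-flow $X$ is proximal if for all $x_1,x_2\in X$ there exist $y\in X$ and a net $(g_i)$ in $G$ with $g_ix_1\to y$ and $g_ix_2\to y$. *)

(* Defs.v *)
From Stdlib Require Import Reals List.
Open Scope R_scope.

Record Group := {
  carrier :> Type;
  gmul : carrier -> carrier -> carrier;
  gone : carrier;
  ginv : carrier -> carrier;
  gmul_assoc : forall a b c, gmul a (gmul b c) = gmul (gmul a b) c;
  gmul_one_l : forall a, gmul gone a = a;
  gmul_one_r : forall a, gmul a gone = a;
  gmul_inv_l : forall a, gmul (ginv a) a = gone;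
  gmul_inv_r : forall a, gmul a (ginv a) = gone
}.

Definition countable_group (G : Group) : Prop :=
  exists f : G -> nat, forall a b, f a = f b -> a = b.

Definition finite_conj_class (G : Group) (g : G) : Prop :=
  exists l : list G, forall h : G, In (gmul G (gmul G h g) (ginv G h)) l.

Definition icc (G : Group) : Prop :=
  forall g : G, g <> gone G -> ~ finite_conj_class G g.

Record topology (X : Type) := {
  is_open : (X -> Prop) -> Prop;
  open_full : is_open (fun _ => True);
  open_inter : forall U V, is_open U -> is_open V -> is_open (fun x => U x /\ V x);
  open_union : forall F : (X -> Prop) -> Prop,
      (forall U, F U -> is_open U) -> is_open (fun x => exists U, F U /\ U x)
}.
Arguments is_open {X} t U.

Definition compact {X : Type} (T : topology X) : Prop :=
  forall F : (X -> Prop) -> Prop,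
    (forall U, F U -> is_open T U) ->
    (forall x, exists U, F U /\ U x) ->
    exists l : list (X -> Prop),
      (forall U, In U l -> F U) /\ (forall x, exists U, In U l /\ U x).

Definition hausdorff {X : Type} (T : topology X) : Prop :=
  forall x y : X, x <> y ->
    exists U V, is_open T U /\ is_open T V /\ U x /\ V y /\
      (forall z, U z -> V z -> False).

Definition continuous {X : Type} (T : topology X) (f : X -> X) : Prop :=
  forall U, is_open T U -> is_open T (fun x => U (f x)).

Definition homeomorphism {X : Type} (T : topology X) (f : X -> X) : Prop :=
  continuous T f /\
  exists g : X -> X, continuous T g /\
    (forall x, g (f x) = x) /\ (forall x, f (g x) = x).

Definition is_metric {X : Type} (d : X -> X -> R) : Prop :=
  (forall x y, 0 <= d x y) /\
  (forall x y, d x y = 0 <-> x = y) /\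
  (forall x y, d x y = d y x) /\
  (forall x y z, d x z <= d x y + d y z).

Definition metrizable {X : Type} (T : topology X) : Prop :=
  exists d : X -> X -> R, is_metric d /\
    forall U : X -> Prop,
      is_open T U <->
      (forall x, U x -> exists eps, 0 < eps /\ forall y, d x y < eps -> U y).

Definition directed_set (D : Type) (le : D -> D -> Prop) : Prop :=
  inhabited D /\
  (forall i, le i i) /\
  (forall i j k, le i j -> le j k -> le i k) /\
  (forall i j, exists k, le i k /\ le j k).

Definition net_converges {X D : Type} (T : topology X) (le : D -> D -> Prop)
    (x : D -> X) (y : X) : Prop :=
  forall U, is_open T U -> U y ->
    exists i0, forall i, le i0 i -> U (x i).

Definition is_G_flow (G : Group) (X : Type) (T : topology X)
    (act : G -> X -> X) : Prop :=
  inhabited X /\ compact T /\ hausdorff T /\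
  (forall x, act (gone G) x = x) /\
  (forall g h x, act (gmul G g h) x = act g (act h x)) /\
  (forall g, homeomorphism T (act g)).

Definition free_action (G : Group) (X : Type) (act : G -> X -> X) : Prop :=
  forall (g : G) (x : X), act g x = x -> g = gone G.

Definition proximal (G : Group) (X : Type) (T : topology X)
    (act : G -> X -> X) : Prop :=
  forall x1 x2 : X, exists y : X,
    exists (D : Type) (le : D -> D -> Prop) (net : D -> G),
      directed_set D le /\
      net_converges T le (fun i => act (net i) x1) y /\
      net_converges T le (fun i => act (net i) x2) y.

(* Main.v *)
From Stdlib Require Import Reals List Lra.
From mathcomp Require Import all_boot zify ring boolp.
Require Import Defs.
Set Implicit Arguments. Unset Strict Implicit. Unset Printing Implicit Defensive.
Declare Scope grp_scope.
Delimit Scope R_scope with Re.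
Local Open Scope nat_scope.
Local Open Scope grp_scope.
Local Notation "a ** b" := (gmul _ a b) (at level 40, left associativity).
Local Notation "a ^-1" := (ginv _ a) : grp_scope.

(** The flow is a closed shift-invariant set of configurations
    x : G -> (nat -> {0,1,2}). Coordinate n of x is a proper 3-colouring for right
    multiplication by the n-th element g_n of G, so g_n^-1 moves x at the identity
    and the action is free.

    Proximality amounts to: any two points agree on some translate of each finite
    set F. It is forced one F at a time. Fix a pattern (E0, p0) with F inside E0
    and let C_x be the set of places where x shows it. For a finite Q, require
    that C_x meets every translate h Q, and that it contains some h w Q with w in
    a fixed finite W; applying the second property to x and the first to y, C_x
    and C_y intersect. The set C_x must be separated, so Q is chosen spread out
    and generic: as G is icc, Neumann's lemma on coverings by cosets makes
    Q meet each g Q D, g <> 1, in boundedly many points. Hence h Q is hardly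
    obstructed by the filled translates, and a separated set hitting all h Q
    exists by the local lemma.

    To iterate, one keeps a class of finite patterns that can be glued together
    when separated. A pattern stays in the class only if each h Q is hit by it or
    barely meets it, which is exactly what lets the hitting set be completed
    outside. Compactness gives a point obeying all the constraints. *)

(** * A local lemma for finite labellings *)

Lemma card_bigcup_le (I T : finType) (P : pred I) (F : I -> {set T}) :
  #|\bigcup_(i | P i) F i| <= \sum_(i | P i) #|F i|.
Proof.
elim/big_rec2: _ => [|i n A _ IH]; first by rewrite cards0.
by apply: leq_trans (leq_card_setU _ _) _; rewrite leq_add2l.
Qed.

Section LocalLemma.
Variables (T L : finType).
Implicit Types (U V : {set T}) (A B : {set {ffun T -> L}}).

Definition determined_on U A : Prop :=
  forall f g : {ffun T -> L}, {in U, f =1 g} -> (f \in A) = (g \in A).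

(** Exchanging the values of two labellings off [U] is an involution on pairs. It sends (f, g) with
    f in both events to a pair in [A] x [B]: the first component is f on [U], the second is f off
    [U], hence on [V]. *)
Lemma card_setI_independent U V A B :
  determined_on U A -> determined_on V B -> [disjoint U & V] ->
  #|A :&: B| * #|{ffun T -> L}| <= #|A| * #|B|.
Proof.
move=> dA dB dUV.
rewrite -(cardsT {ffun T -> L}) -!cardsX.
pose mix (f g : {ffun T -> L}) := [ffun t => if t \in U then f t else g t].
pose swap (u : {ffun T -> L} * {ffun T -> L}) := (mix u.1 u.2, mix u.2 u.1).
have swap_inj : injective swap.
  apply: (can_inj (g := swap)) => -[f g]; rewrite /swap /=.
  by congr (_, _); apply/ffunP => t; rewrite !ffunE; case: (t \in U).
rewrite -(card_imset _ swap_inj); apply: subset_leq_card.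
apply/subsetP => _ /imsetP[[f g] /setXP[/setIP[fA fB] _] ->].
apply/setXP; split => /=.
  by rewrite (dA _ f) // => t tU; rewrite ffunE tU.
rewrite (dB _ f) // => t tV; rewrite ffunE.
by rewrite (disjointFl dUV tV).
Qed.

(** Events are peeled off one at a time: the remaining ones are jointly determined on the union of
    their scopes, which is disjoint from [sc j]. Each event of probability at most v/u contributes
    one factor. *)
Lemma card_bigcap_independent (J : finType) (Z : {set J}) (sc : J -> {set T})
    (A : J -> {set {ffun T -> L}}) u v :
  (forall j, determined_on (sc j) (A j)) ->
  {in Z &, forall i j, i != j -> [disjoint sc i & sc j]} ->
  {in Z, forall j, #|A j| * u <= v * #|{ffun T -> L}|} ->
  #|\bigcap_(j in Z) A j| * u ^ #|Z| <= v ^ #|Z| * #|{ffun T -> L}|.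
Proof.
move=> dA dis bnd.
have [n] := ubnP #|Z|; elim: n Z dis bnd => // n IH Z dis bnd Zn.
have [->|[j jZ]] := set_0Vmem Z.
  by rewrite big_set0 cards0 !muln1 mul1n cardsT.
rewrite (cardsD1 j) jZ add1n (big_setD1 j jZ) /=.
set Z' := Z :\ j.
have subZ i : i \in Z' -> i \in Z by case/setD1P.
have IHZ : #|\bigcap_(i in Z') A i| * u ^ #|Z'| <= v ^ #|Z'| * #|{ffun T -> L}|.
  apply: IH => [i i' /subZ iZ /subZ i'Z|i /subZ iZ|]; [exact: dis|exact: bnd|].
  by move: Zn; rewrite (cardsD1 j) jZ.
have dcap : determined_on (\bigcup_(i in Z') sc i) (\bigcap_(i in Z') A i).
  move=> f g fg; apply/bigcapP/bigcapP => H i iZ; move: (H i iZ);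
    rewrite (dA i f g) // => t ti; apply: fg; apply/bigcupP; by exists i.
have disj : [disjoint sc j & \bigcup_(i in Z') sc i].
  apply: bigcup_disjoint => i /setD1P[ij iZ].
  by apply: dis; rewrite // eq_sym.
have /= ind := card_setI_independent (dA j) dcap disj.
have [L0|Lpos] := posnP #|{ffun T -> L}|.
  rewrite L0 muln0 leqn0 muln_eq0.
  have : #|A j :&: \bigcap_(i in Z') A i| <= #|{ffun T -> L}| by exact: max_card.
  by rewrite L0 leqn0 => ->.
rewrite -(leq_pmul2r Lpos) !expnS.
have b := bnd j jZ.
apply: (@leq_trans ((#|A j| * u) * (#|\bigcap_(i in Z') A i| * u ^ #|Z'|))).
  rewrite [X in _ <= X]mulnACA [X in X <= _]mulnAC; exact: leq_mul.
apply: leq_trans (leq_mul b IHZ) _.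
by rewrite mulnACA -!mulnA.
Qed.

(** Bernoulli with denominators cleared: (1 - 1/(2s))^r >= 1 - r/(2s) >= 1/2. *)
Lemma bernoulli_half s r : r <= s -> 0 < s -> (2 * s) ^ r <= 2 * (2 * s).-1 ^ r.
Proof.
move=> rs s0.
suff : (2 * s - r) * (2 * s) ^ r <= 2 * s * (2 * s).-1 ^ r.
  move=> H; rewrite -(leq_pmul2l s0) mulnA (mulnC s 2).
  by apply: leq_trans H; rewrite leq_mul2r; apply/orP; right; lia.
elim: r rs => [|r IH] rs; first by rewrite !expn0 !muln1; lia.
have := IH (ltnW rs); rewrite !expnS.
set a := (2 * s) ^ r; set b := (2 * s).-1 ^ r => H.
have : (2 * s - r) * (2 * s).-1 * a <= 2 * s * ((2 * s).-1 * b).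
  by rewrite mulnAC (mulnCA (2 * s)) mulnC; apply: leq_mul.
apply: leq_trans; rewrite mulnA leq_mul2r; apply/orP; right.
nia.
Qed.

(* Rosenfeld's counting form of the Lovasz local lemma: revealing one more
   site multiplies the number of good labellings by at least 1 - 1/(2s). *)
Lemma local_lemma (I : finType) (bad : I -> {set {ffun T -> L}})
    (sc : I -> {set T}) s Delta :
  0 < s -> 0 < Delta -> 0 < #|{ffun T -> L}| ->
  (forall i, determined_on (sc i) (bad i)) ->
  (forall i, #|sc i| <= s) ->
  (forall t, #|[set i | t \in sc i]| <= Delta) ->
  (forall i, 4 * s * Delta * #|bad i| <= #|{ffun T -> L}|) ->
  exists f, forall i, f \notin bad i.
Proof.
move=> s0 D0 O0 dbad scs scD pbad.
pose V U := [set f | [forall i, (sc i \subset U) ==> (f \notin bad i)]].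
have VP U f : reflect (forall i, sc i \subset U -> f \notin bad i) (f \in V U).
  rewrite inE; apply: (iffP forallP) => H i; first by apply/implyP.
  apply/implyP; exact: H.
have dV U : determined_on U (V U).
  move=> f g fg; apply/VP/VP => H i iU; move: (H i iU);
  by rewrite (dbad i f g) // => t ti; apply: fg; apply: (subsetP iU).
(* An event with empty scope is empty or everything, and the bound on [bad i] excludes the
   latter. *)
have V0 : V set0 = setT.
  apply/setP => f; rewrite [RHS]inE; apply/VP => i; rewrite subset0 => /eqP si.
  apply/negP => fb.
  have badT : bad i = setT.
    apply/setP => g; rewrite [RHS]inE -(dbad i f g) //= => t.
    by rewrite si inE.
  have := pbad i; rewrite badT cardsT leqNgt -{1}[#|_|]mul1n ltn_pmul2r //.
  have : 0 < s * Delta by rewrite muln_gt0 s0.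
  by move=> sD; rewrite -mulnA; lia.
have grow U : forall U', U' \subset U ->
    (2 * s).-1 ^ #|U :\: U'| * #|V U'| <= (2 * s) ^ #|U :\: U'| * #|V U|.
  have [n] := ubnP #|U|; elim: n U => // n IH U Un U' sU.
  have [U'U|] := boolP (U \subset U').
    have -> : U' = U by apply/eqP; rewrite eqEsubset sU.
    by rewrite setDv cards0 !expn0.
  case/subsetPn => b bU bU'.
  pose X := U :\ b.
  have UX : #|U| = #|X|.+1 by rewrite (cardsD1 b) bU.
  have Xn : #|X| < n by rewrite -UX; lia.
  have U'X : U' \subset X by rewrite subsetD1 sU.
  have H1 := IH X Xn U' U'X.
  have -> : #|U :\: U'| = #|X :\: U'|.+1.
    rewrite (cardsD1 b) !inE bU bU' /= add1n; congr _.+1.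
    by apply: eq_card => t; rewrite !inE; case: (t == b); rewrite ?andbF //.
  suff step : (2 * s).-1 * #|V X| <= 2 * s * #|V U|.
    rewrite !expnS -(mulnA (2 * s)) -(mulnA (2 * s).-1).
    apply: (@leq_trans ((2 * s).-1 * ((2 * s) ^ #|X :\: U'| * #|V X|))).
      by apply: leq_mul.
    by rewrite mulnCA [X in _ <= X]mulnCA; apply: leq_mul.
  (* An event through [b] costs at most the fraction 1/(2 s Delta) of [V X]. Forgetting its whole
     scope makes it independent of what is still imposed, and by induction and Bernoulli this at
     most doubles the count. *)
  have lossi i : b \in sc i ->
      2 * s * Delta * #|V (U :\: sc i) :&: bad i| <= #|V X|.
    move=> bi; set Y := U :\: sc i.
    have YX : Y \subset X by rewrite subsetD1 subsetDl !inE bi.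
    have dis : [disjoint Y & sc i].
      by rewrite disjoints_subset; apply/subsetP => t; rewrite !inE; case/andP.
    have ind := card_setI_independent (dV Y) (dbad i) dis.
    have HY := IH X Xn Y YX.
    have rs : #|X :\: Y| <= s.
      apply: leq_trans (scs i); apply: subset_leq_card; apply/subsetP => t.
      by rewrite !inE; case: (t \in sc i) => //=; case: (t \in U); rewrite ?andbF.
    have Hb := bernoulli_half rs s0.
    have VY : #|V Y| <= 2 * #|V X|.
      have p0 : 0 < (2 * s).-1 ^ #|X :\: Y| by rewrite expn_gt0; lia.
      rewrite -(leq_pmul2l p0); apply: leq_trans HY _.
      by rewrite mulnCA mulnA; apply: leq_mul.
    have := pbad i; move: ind VY.
    set a := #|V Y :&: _|; set o := #|{ffun T -> L}|; set y := #|V Y|.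
    set x := #|V X|; set bb := #|bad i| => ind VY pb.
    rewrite -(@leq_pmul2l (2 * o)); last by rewrite muln_gt0.
    apply: (@leq_trans ((4 * s * Delta) * (y * bb))).
      have -> : 2 * o * (2 * s * Delta * a) = 4 * s * Delta * (a * o) by ring.
      by apply: leq_mul.
    apply: (@leq_trans (y * o)).
      by rewrite mulnCA; apply: leq_mul.
    by rewrite mulnAC; apply: leq_mul.
  (* A labelling lost on revealing [b] lies in a bad event through [b], and there are at most
     [Delta] of these. *)
  have loss : 2 * s * #|V X :\: V U| <= #|V X|.
    have sub : V X :\: V U \subset
        \bigcup_(i in [set i | b \in sc i]) (V (U :\: sc i) :&: bad i).
      apply/subsetP => f; rewrite inE => /andP[fU /VP fX].
      have : exists i, (sc i \subset U) && (f \in bad i).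
        apply/existsP; apply: contraR fU; rewrite negb_exists => /forallP H.
        by apply/VP => i iU; have := H i; rewrite iU.
      case=> i /andP[iU fi].
      have bsc : b \in sc i.
        apply/negPn/negP => bi.
        have iX : sc i \subset X by rewrite subsetD1 iU.
        by have := fX i iX; rewrite fi.
      apply/bigcupP; exists i; first by rewrite inE.
      rewrite inE fi andbT; apply/VP => j jY; apply: (fX j).
      apply/subsetP => t /(subsetP jY); rewrite !inE => /andP[ti ->].
      rewrite andbT; apply: contra ti => /eqP ->; exact: bsc.
    have := leq_trans (subset_leq_card sub) (card_bigcup_le _ _).
    set S := [set i | b \in sc i] => H.
    apply: (@leq_trans (2 * s * \sum_(i in S) #|V (U :\: sc i) :&: bad i|)).
      by rewrite leq_mul2l H orbT.
    rewrite -(leq_pmul2l D0) mulnA (mulnC Delta) big_distrr /=.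
    apply: (@leq_trans (\sum_(i in S) #|V X|)).
      by apply: leq_sum => i; rewrite inE => /lossi.
    by rewrite sum_nat_const leq_mul2r scD orbT.
  have : #|V X| <= #|V X :\: V U| + #|V U|.
    rewrite -(cardsID (V U) (V X)) addnC leq_add2l.
    by apply: subset_leq_card; apply: subsetIr.
  nia.
have := grow setT set0 (sub0set _).
rewrite V0 cardsT => H.
have [f fV] : exists f, f \in V setT.
  apply/card_gt0P; have p0 : 0 < (2 * s).-1 ^ #|[set: T] :\: set0|.
    by rewrite expn_gt0; lia.
  rewrite lt0n; apply/eqP => E0.
  by move: H; rewrite E0 muln0 leqNgt muln_gt0 p0 O0.
by exists f => i; apply: (elimT (VP _ _) fV i (subsetT _)).
Qed.
End LocalLemma.

(** * Generic sequences in an icc group *)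

Section GroupLaws.
Variable G : Group.
Implicit Types (a b c : G).

Lemma gmulA a b c : a ** b ** c = a ** (b ** c).
Proof. by rewrite gmul_assoc. Qed.
Lemma gmul1 a : gone G ** a = a. Proof. exact: gmul_one_l. Qed.
Lemma gmulr1 a : a ** gone G = a. Proof. exact: gmul_one_r. Qed.
Lemma gmulV a : a^-1 ** a = gone G. Proof. exact: gmul_inv_l. Qed.
Lemma gmulrV a : a ** a^-1 = gone G. Proof. exact: gmul_inv_r. Qed.
Lemma gmulKV a b : a ** (a^-1 ** b) = b. Proof. by rewrite gmul_assoc gmulrV gmul1. Qed.
Lemma gmulVK a b : a^-1 ** (a ** b) = b. Proof. by rewrite gmul_assoc gmulV gmul1. Qed.
Lemma ginv_unique a b : a ** b = gone G -> b = a^-1.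
Proof. by move=> ab; rewrite -(gmulVK a b) ab gmulr1. Qed.
Lemma ginvK a : a^-1^-1 = a. Proof. by symmetry; apply: ginv_unique; apply: gmulV. Qed.
Lemma ginv1 : (gone G)^-1 = gone G. Proof. by symmetry; apply: ginv_unique; apply: gmul1. Qed.
Lemma ginvM a b : (a ** b)^-1 = b^-1 ** a^-1.
Proof. by symmetry; apply: ginv_unique; rewrite gmulA gmulKV gmulrV. Qed.
End GroupLaws.

Local Notation gnorm := (gmulA, gmul1, gmulr1, gmulV, gmulrV, gmulKV, gmulVK, ginvK, ginv1, ginvM).


Lemma In_enum (T : finType) (x : T) : List.In x (enum T).
Proof.
have : x \in enum T by rewrite mem_enum.
by elim: (enum T) => // y s IH; rewrite inE => /orP[/eqP ->|/IH]; [left|right].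
Qed.

Section GroupFacts.
Variable G : Group.
Implicit Types (a b c x y : G) (A B C : G -> Prop).


Lemma gmulI a b c : a ** b = a ** c -> b = c.
Proof. by move=> E; rewrite -(gmulVK a b) E gmulVK. Qed.
Lemma gmulIr a b c : b ** a = c ** a -> b = c.
Proof. by move=> E; have := congr1 (fun z => z ** a^-1) E; rewrite !gnorm. Qed.

Definition fin A : Prop := exists l : list G, forall x, A x -> List.In x l.
Definition pmul A B x : Prop := exists a b, [/\ A a, B b & x = a ** b].
Definition pinv A x : Prop := A x^-1.
Definition por A B x : Prop := A x \/ B x.
Definition psing a x : Prop := x = a.

Lemma fin_sub A B : (forall x, A x -> B x) -> fin B -> fin A.
Proof. by move=> AB [l lB]; exists l => x /AB/lB. Qed.
Lemma fin_psing a : fin (psing a).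
Proof. by exists [:: a] => x ->; left. Qed.
Lemma fin_por A B : fin A -> fin B -> fin (por A B).
Proof.
move=> [l lA] [k kB]; exists (l ++ k)%list => x [/lA|/kB] H;
  apply: in_or_app; [by left|by right].
Qed.
Lemma fin_pmul A B : fin A -> fin B -> fin (pmul A B).
Proof.
move=> [l lA] [k kB]; exists (List.map (fun u => u.1 ** u.2) (list_prod l k)).
move=> _ [a [b [/lA al /kB bk ->]]].
by apply: (in_map (fun u => u.1 ** u.2) _ (a, b)); apply: in_prod.
Qed.
Lemma fin_pinv A : fin A -> fin (pinv A).
Proof.
move=> [l lA]; exists (List.map (ginv G) l) => x /lA H.
by rewrite -(ginvK x); apply: in_map.
Qed.
Lemma fin_range m (q : nat -> G) : fin (fun x => exists2 i, i < m & x = q i).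
Proof.
exists (List.map q (List.seq 0 m)) => x [i im ->].
by apply/in_map/in_seq; lia.
Qed.

Lemma fin_codom m (q : 'I_m -> G) : fin (fun x => exists i, x = q i).
Proof.
exists (List.map q (enum 'I_m)) => _ [i ->]; apply: in_map; exact: In_enum.
Qed.

Lemma pmulI A B a b : A a -> B b -> pmul A B (a ** b).
Proof. by move=> *; exists a, b. Qed.

Lemma fin_enum A : fin A -> exists N (b : 'I_N -> G),
  injective b /\ forall x, A x <-> exists i, x = b i.
Proof.
case=> l lA; pose T : eqType := {classic (carrier G)}.
pose s : seq T := @undup T (@filter T (fun x => `[< A x >]) l).
have sP (x : T) : x \in s <-> A x.
  rewrite mem_undup mem_filter; split=> [/andP[/asboolP]//|Ax].
  apply/andP; split; first exact/asboolP.
  move: (lA x Ax) => {lA}; rewrite {}/s.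
  by elim: l => //= y l' IH [->|/IH H]; rewrite inE ?eqxx // H orbT.
exists (size s), (tnth (in_tuple s)); split.
  move=> i j; rewrite !(tnth_nth (gone G : T)) => E; apply/val_inj/eqP.
  by rewrite -(@nth_uniq T (gone G) s) ?undup_uniq ?(ltn_ord i) ?(ltn_ord j) //; apply/eqP.
move=> x; split=> [/sP xs|[i ->]].
  by have [i xi] := elimT (tnthP (in_tuple s) x) xs; exists i.
by apply/sP/mem_tnth.
Qed.

Hypothesis iccG : icc G.

(* B.H. Neumann: finitely many cosets of infinite-index subgroups (here
   centralizers) never cover G. The coset of C(d) over a target t is moved by
   g f^-1 off all targets of d, which trades d for more targets of the rest. *)
Lemma neumann (ds : list G) : (forall d, List.In d ds -> d <> gone G) ->
  forall L : G -> list G, exists q, forall d, List.In d ds ->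
    ~ List.In (q ** d ** q^-1) (L d).
Proof.
elim: ds => [|d ds IH] ds1 L; first by exists (gone G).
have [g gL] : exists g, ~ List.In (g ** d ** g^-1) (L d).
  apply: contrapT => H; apply: (iccG (ds1 d (or_introl erefl))).
  by exists (L d) => h; apply: contrapT => nh; apply: H; exists h.
(* [f t] represents the coset of C(d) whose elements conjugate [d] to [t]; a [t] that is no
   conjugate gets a default value. *)
have /choice [f fP] t : exists f, (exists h, t = h ** d ** h^-1) -> t = f ** d ** f^-1.
  have [[h ->]|no] := pselect (exists h, t = h ** d ** h^-1); first by exists h.
  by exists t => /no.
pose u t := g ** (f t)^-1.
(* The added targets are those of d' conjugated back by each [u t], so that [u t ** q] is as safe as
   [q]. *)
pose L' d' := (L d' ++ List.flat_map
  (fun t => List.map (fun x => (u t)^-1 ** x ** u t) (L d')) (L d))%list.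
have [d' d'ds|q qL] := IH _ L'; first by apply: ds1; right.
have [qd|] := pselect (List.In (q ** d ** q^-1) (L d)); last first.
  move=> qd; exists q => d' [<- //|d'ds H]; apply: (qL d' d'ds).
  by apply: in_or_app; left.
set t := q ** d ** q^-1 in qd.
have ft : t = f t ** d ** (f t)^-1 by apply: fP; exists q.
have uq x : (u t ** q) ** x ** (u t ** q)^-1 = u t ** (q ** x ** q^-1) ** (u t)^-1.
  by rewrite !gnorm.
exists (u t ** q) => d' [<-|d'ds] H.
  apply: gL; move: H; rewrite uq -/t {2}ft /u.
  by rewrite !gnorm.
apply: (qL d' d'ds); apply: in_or_app; right; apply/in_flat_map.
exists t; split=> //; move: H; rewrite uq.
set y := q ** d' ** q^-1 => H.
have -> : y = (u t)^-1 ** (u t ** y ** (u t)^-1) ** u t by rewrite !gnorm.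
exact: (in_map (fun x => (u t)^-1 ** x ** u t)).
Qed.

Hypothesis ntG : exists d, d <> gone G.

Lemma generic_element (D Bad Tg : G -> Prop) : fin D -> fin Bad -> fin Tg ->
  exists q, ~ Bad q /\ forall d, D d -> d <> gone G -> ~ Tg (q ** d ** q^-1).
Proof.
move=> [lD lDP] [lB lBP] [lT lTP]; have [d0 d01] := ntG.
(* To keep [q] out of [Bad], it is forbidden to conjugate [d] the way any b in [Bad] does; [d0]
   guarantees that some [d] is present to test. *)
pose ds := d0 :: List.filter (fun d => `[< d <> gone G >]) lD.
pose L d := (lT ++ List.map (fun b => b ** d ** b^-1) lB)%list.
have [d|q qP] := @neumann ds _ L.
  by case=> [<- //|/filter_In [_ /asboolP]].
exists q; split=> [/lBP qB|d /lDP dD d1 /lTP H].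
  apply: (qP d0 (or_introl erefl)); apply: in_or_app; right.
  exact: (in_map (fun b => b ** d0 ** b^-1)).
apply: (qP d); last by apply: in_or_app; left.
by right; apply/filter_In; split=> //; apply/asboolP.
Qed.

Lemma avoid_finite (Bad : G -> Prop) : fin Bad -> exists q, ~ Bad q.
Proof.
move=> fB; have [q [qB _]] := generic_element (fin_psing (gone G)) fB fB.
by exists q.
Qed.

Section Spread.
Variable D : G -> Prop.
Hypotheses (finD : fin D) (DV : forall d, D d -> D d^-1).

(* All coincidences of q with a translate g q D involve a single index,
   because q_m is chosen generic with respect to q_0, ..., q_(m-1). *)
Lemma generic_sequence m : exists q : nat -> G,
  (forall i j d d', i < m -> j < m -> D d -> D d' -> q i ** d = q j ** d' -> i = j) /\
  (forall g, g <> gone G -> exists k, forall i j d, i < m -> j < m -> D d ->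
     q i = g ** q j ** d -> i = k \/ j = k).
Proof.
elim: m => [|m [q [spr gen]]]; first by exists (fun=> gone G); split=> // g _; exists 0.
pose Qm x := exists2 i, i < m & x = q i.
have finQ : fin Qm by exact: fin_range.
(* [Gm] contains each [g] for which the earlier points already have a coincidence; the new point
   must add none for these. *)
pose Gm := pmul Qm (pmul D (pinv Qm)).
have finGm : fin Gm 
  by apply: fin_pmul => //; apply: fin_pmul => //; apply: fin_pinv.
pose Bad := por (pmul Gm (pmul Qm D)) (por (pmul (pinv Gm) (pmul Qm D)) (pmul Qm (pmul D D))).
have finBad : fin Bad.
  apply: fin_por; first by apply: fin_pmul => //; apply: fin_pmul.
  apply: fin_por; first by apply: fin_pmul; [exact: fin_pinv|exact: fin_pmul].
  by apply: fin_pmul => //; apply: fin_pmul.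
have [c [cB cT]] := generic_element finD finBad finGm.
have Qi i : i < m -> Qm (q i) by exists i.
have Gmi g i j d : i < m -> j < m -> D d -> q i = g ** q j ** d -> Gm g.
  move=> im jm Dd E; exists (q i), (d^-1 ** (q j)^-1); split; [exact: Qi| |].
    by apply: pmulI; [exact: DV|rewrite /pinv ginvK; exact: Qi].
  by rewrite E !gnorm.
have lt i : i < m.+1 -> i != m -> i < m by move=> im /eqP; lia.
exists (fun i => if i == m then c else q i); split.
  move=> i j d d' im1 jm1 Dd Dd'.
  have [->|/(lt _ im1) im] := eqVneq i m; have [->|/(lt _ jm1) jm] := eqVneq j m => // E.
  - case: cB; right; right; exists (q j), (d' ** d^-1); split; [exact: Qi| |].
      by apply: pmulI => //; exact: DV.
    by rewrite gmul_assoc -E !gnorm.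
  - case: cB; right; right; exists (q i), (d ** d'^-1); split; [exact: Qi| |].
      by apply: pmulI => //; exact: DV.
    by rewrite gmul_assoc E !gnorm.
  - exact: spr E.
move=> g g1.
have [Gg|nGg] := pselect (Gm g); last first.
  (* Outside [Gm] every coincidence involves the new index [m]. *)
  exists m => i j d im1 jm1 Dd.
  have [->|/(lt _ im1) im] := eqVneq i m; first by left.
  have [->|/(lt _ jm1) jm] := eqVneq j m; first by right.
  by move=> E; case: nGg; apply: Gmi E.
have [k kP] := gen g g1; exists k => i j d im1 jm1 Dd.
have [->|/(lt _ im1) im] := eqVneq i m; have [->|/(lt _ jm1) jm] := eqVneq j m => // E.
(* Here c = g c d says that c conjugates d^-1 to an element of [Gm], which genericity forbids. *)
- have d1 : d^-1 <> gone G.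
    move=> d1; apply: g1; move: E; rewrite -(ginvK d) d1 !gnorm => E.
    by apply: (@gmulIr c); rewrite gmul1 -E.
  case: (cT d^-1 (DV Dd) d1).
  have -> // : c ** d^-1 ** c^-1 = g by rewrite {1}E !gnorm.
- case: cB; left; exists g, (q j ** d); split=> //; last by rewrite gmul_assoc.
  by apply: pmulI => //; exact: Qi.
- case: cB; right; left; exists g^-1, (q i ** d^-1); split.
  + by rewrite /pinv ginvK.
  + by apply: pmulI; [exact: Qi|exact: DV].
  + by rewrite E !gnorm.
- exact: kP E.
Qed.
End Spread.
End GroupFacts.

(** * Separated sets hitting all translates *)

Lemma card_le_rel (S U : finType) (A : {set S}) (Rel : S -> U -> Prop) :
  (forall x, x \in A -> exists u, Rel x u) ->
  (forall x y u, Rel x u -> Rel y u -> x = y) -> #|A| <= #|U|.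
Proof.
move=> ex inj.
have /choice [F FP] (x : {x | x \in A}) : exists u, Rel (val x) u.
  by case: x => x xA; apply: ex.
have Finj : injective F.
  by move=> x y E; apply: val_inj; apply: (inj _ _ (F x)) => //; rewrite E.
by have := leq_card F Finj; rewrite card_sig.
Qed.

Lemma exists_subset_card (S : finType) (A : {set S}) n : n <= #|A| ->
  exists2 Z : {set S}, Z \subset A & #|Z| = n.
Proof.
move=> nA; exists [set x in take n (enum A)].
  by apply/subsetP => x; rewrite inE => /mem_take; rewrite mem_enum.
rewrite cardsE (card_uniqP (take_uniq _ (enum_uniq _))) size_takel //.
by rewrite -cardE.
Qed.

(** Bernoulli again: (1 + 1/a)^b >= 1 + b/a, taken at b = a. *)
Lemma expn_double a : 0 < a -> 2 * a ^ a <= a.+1 ^ a.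
Proof.
move=> a0.
suff H b : a ^ b * (a + b) <= a * a.+1 ^ b.
  have := H a; rewrite -(leq_pmul2l a0).
  by move: (a ^ a) (a.+1 ^ a) => x y; nia.
elim: b => [|b IH]; first by rewrite !expn0 addn0 mul1n muln1.
rewrite !expnS; move: (a ^ b) (a.+1 ^ b) IH => x y IH; nia.
Qed.

Section ZeroLabels.
Variables (T : finType) (l : nat).
Local Notation Omega := {ffun T -> 'I_l.+1}.

(** Label 0 marks a site as selected, an event of probability 1/(l+1). *)
Definition zero_at (t : T) : {set Omega} := [set f : Omega | f t == ord0].

Lemma determined_zero_at t (U : {set T}) : t \in U -> determined_on U (zero_at t).
Proof. by move=> tU f g fg; rewrite !inE fg. Qed.

Lemma card_zero_at t : #|zero_at t| * l.+1 = #|Omega|.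
Proof.
(* Overwriting the label at [t] maps [zero_at t] times the labels bijectively onto all
   labellings. *)
pose upd (u : Omega * 'I_l.+1) : Omega := [ffun s => if s == t then u.2 else u.1 s].
have inj : {in setX (zero_at t) setT &, injective upd}.
  move=> [f a] [g b] /setXP[/=]; rewrite inE => /eqP f0 _ /setXP[/=].
  rewrite inE => /eqP g0 _ /ffunP E; congr (_, _).
    apply/ffunP => s; have := E s; rewrite !ffunE /=.
    by case: eqVneq => [->|//]; rewrite f0 g0.
  by have := E t; rewrite !ffunE /= eqxx.
have im : upd @: setX (zero_at t) setT = setT.
  apply/setP => f; rewrite [RHS]inE; apply/imsetP.
  exists ([ffun s => if s == t then ord0 else f s], f t).
    by rewrite !inE ffunE eqxx.
  by apply/ffunP => s; rewrite !ffunE /=; case: eqVneq => [->|].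
by rewrite -(cardsT Omega) -im card_in_imset // cardsX cardsT card_ord.
Qed.

Definition touched (B : {set T}) : {set Omega} := [set f : Omega | [exists t in B, f t == ord0]].

Lemma determined_touched B : determined_on B (touched B).
Proof.
move=> f g fg; rewrite !inE; apply/existsP/existsP => -[t /andP[tB ft]];
  by exists t; rewrite tB -?(fg t tB) // (fg t tB).
Qed.

Lemma card_touched B : #|touched B| * l.+1 <= #|B| * #|Omega|.
Proof.
have sub : touched B \subset \bigcup_(t in B) zero_at t.
  apply/subsetP => f; rewrite inE => /existsP[t /andP[tB ft]].
  by apply/bigcupP; exists t; rewrite // inE.
have := leq_trans (subset_leq_card sub) (card_bigcup_le _ _).
rewrite -(leq_pmul2r (ltn0Sn l)) big_distrl /=.
by under eq_bigr do rewrite card_zero_at; rewrite sum_nat_const.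
Qed.

Definition isolated (B : {set T}) (t : T) : {set Omega} :=
  [set f : Omega | (f t == ord0) && [forall s in B, (f s == ord0) ==> (s == t)]].

Lemma determined_isolated (B : {set T}) t : t \in B -> determined_on B (isolated B t).
Proof.
move=> tB f g fg; rewrite !inE (fg t tB); congr (_ && _).
apply: eq_forallb => s; have [sB|//] := boolP (s \in B).
by rewrite (fg s sB).
Qed.

(** From the probability 1/L that [t] is selected, subtract 1/L^2 for each other site of [B]
    selected with it. As 2|B| <= L, at least 1/(2L) remains. *)
Lemma card_isolatedC (B : {set T}) t : 2 * #|B| <= l.+1 -> t \in B ->
  #|~: isolated B t| * (2 * l.+1) <= (2 * l.+1).-1 * #|Omega|.
Proof.
move=> Bl tB; set L := l.+1 in Bl *; have L0 : 0 < L by [].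
have sub : zero_at t \subset
    isolated B t :|: \bigcup_(s in B :\ t) (zero_at t :&: zero_at s).
  apply/subsetP => f; rewrite !inE => f0; rewrite f0 /=.
  have [//|] := boolP [forall s in B, (f s == ord0) ==> (s == t)].
  rewrite negb_forall => /existsP[s]; rewrite !negb_imply => /and3P[sB fs st]; apply/bigcupP; exists s.
    by rewrite !inE st.
  by rewrite !inE f0.
have le1 := leq_trans (leq_trans (subset_leq_card sub) (leq_card_setU _ _))
  (leq_add (leqnn _) (card_bigcup_le _ _)).
set O := #|Omega|; have O0 : 0 < O by apply/card_gt0P; exists [ffun=> ord0].
have two s : s \in B :\ t -> #|zero_at t :&: zero_at s| * (L * L) <= O.
  rewrite !inE => /andP[st sB].
  have /= := card_setI_independent (determined_zero_at (set11 t))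
    (determined_zero_at (set11 s)).
  rewrite disjoints1 inE eq_sym st => /(_ isT).
  rewrite -(card_zero_at t) -(leq_pmul2r L0) -/L.
  move: (card_zero_at t) (card_zero_at s); rewrite -/L -/O.
  set x := #|_ :&: _|; set y := #|zero_at t|; set z := #|zero_at s| => Ey Ez.
  move=> H; rewrite -(leq_pmul2r O0).
  have -> : x * (L * L) * O = x * (y * L) * L * L by rewrite Ey; ring.
  have -> : O * O = (y * z * L) * L by rewrite -{1}Ey -Ez; ring.
  by rewrite leq_pmul2r.
have le2 : L * L * \sum_(s in B :\ t) #|zero_at t :&: zero_at s| <= #|B| * O.
  rewrite big_distrr /=; apply: (@leq_trans (\sum_(s in B :\ t) O)).
    by apply: leq_sum => s sB; rewrite mulnC two.
  by rewrite sum_nat_const leq_mul2r subset_leq_card ?orbT // subD1set.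
move: le1 le2 (card_zero_at t); rewrite -/L -/O.
have := cardsC (isolated B t); rewrite -/O.
set S := \sum_(_ in _) _; set c := #|~: _|; set i := #|isolated _ _|.
set z := #|zero_at t| => Ec le1 le2 Ez.
have H : L * O <= L * L * i + #|B| * O.
  apply: (@leq_trans (L * L * (i + S))).
    have -> : L * O = L * L * z by rewrite -Ez; ring.
    by rewrite leq_mul2l le1 orbT.
  by rewrite mulnDr leq_add2l.
have H2 : O <= 2 * L * i.
  have : 2 * (#|B| * O) <= L * O by rewrite mulnA leq_mul2r Bl orbT.
  move=> H3; rewrite -(leq_pmul2l L0); nia.
nia.
Qed.
End ZeroLabels.

(* The numerical condition of the local lemma: with L = 1024 n labels and
   m = 8 k points, both kinds of bad event have probability exponentially
   small in k, while scopes and degrees are at most 8 k n. *)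
Lemma hitting_parameters n kappa : 0 < n -> exists k, [/\ kappa <= k, 0 < k &
  forall o b1 b2, 
    b1 * (2 * (n * 1024)) ^ (4 * k) <= (2 * (n * 1024)).-1 ^ (4 * k) * o ->
    b2 * 1024 ^ k.+1 <= 2 ^ (8 * k) * o ->
    4 * (8 * k * n) * (8 * k * n) * (b1 + b2) <= o].
Proof.
move=> n0; set L := n * 1024; set a := (2 * L).-1.
have a0 : 0 < a by rewrite /a /L; lia.
have aL : 2 * L = a.+1 by rewrite /a /L; lia.
(* With k = a j, the k-th powers yield a gain of 2^(4j) by [expn_double], and 2^(4j) >= j^4 beats
   the factor quadratic in k once j >= 32 a n. *)
pose j := 32 * a * n + kappa; exists (a * j).
have j0 : 0 < j by rewrite /j; nia.
split; [rewrite /j; nia|by rewrite muln_gt0 a0|] => o b1 b2; rewrite aL => H1 H2.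
have B1 : b1 * 2 ^ (4 * j) <= o.
  have E x : x ^ (4 * (a * j)) = (x ^ a) ^ (4 * j) by rewrite -expnM; congr (_ ^ _); ring.
  rewrite !E in H1.
  have p0 : 0 < (a ^ a) ^ (4 * j) by rewrite !expn_gt0 a0.
  rewrite -(leq_pmul2r p0) -mulnA -expnMn (mulnC o); apply: leq_trans H1.
  by rewrite leq_mul2l leq_exp2r ?expn_double ?orbT //; lia.
have B2 : b2 * 2 ^ (4 * j) <= o.
  have p0 : 0 < 2 ^ (8 * (a * j)) by rewrite expn_gt0.
  rewrite -(leq_pmul2r p0) -mulnA -expnD (mulnC o); apply: leq_trans H2.
  rewrite leq_mul2l (_ : 1024 = 2 ^ 10) // -expnM leq_exp2l //; apply/orP; right.
  have : 2 <= a by rewrite /a /L; lia.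
  nia.
have j4 : j ^ 4 <= 2 ^ (4 * j).
  by rewrite (mulnC 4) expnM leq_exp2r //; apply: ltnW; apply: ltn_expl.
have K : 4 * (8 * (a * j) * n) * (8 * (a * j) * n) * 2 <= 2 ^ (4 * j).
  apply: leq_trans j4.
  have -> : 4 * (8 * (a * j) * n) * (8 * (a * j) * n) * 2 = 512 * (a * n * (a * n)) * (j * j) by ring.
  have -> : j ^ 4 = (j * j) * (j * j) by rewrite !expnS expn0; ring.
  rewrite leq_mul2r; apply/orP; right.
  have : 32 * (a * n) <= j by rewrite /j mulnA leq_addr.
  move: (a * n) => x xj; nia.
rewrite mulnDr; set c := 4 * _ * _ in K *.
have half b : b * 2 ^ (4 * j) <= o -> 2 * (c * b) <= o.
  move=> H; apply: leq_trans H; rewrite (_ : 2 * (c * b) = b * (c * 2)); last by ring.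
  by rewrite leq_mul2l K orbT.
have := half _ B1; have := half _ B2; lia.
Qed.

Section Hitting.
Variables (G : Group) (D : G -> Prop).
Hypotheses (finD : fin D) (D1 : D (gone G)) (DV : forall d, D d -> D d^-1).

(** The sites of [Al] are labelled at random, and a site labelled 0 is kept if no other 0 lies
    within [D] of it. By the local lemma one can avoid, for all relevant h at once, that h Q has no
    kept site and that more than k of the disjoint sets h q_i D contain a 0. *)
Lemma hitting (kappa : nat) : exists k, [/\ kappa <= k, 0 < k &
  forall (q : 'I_(8 * k) -> G) (Al H : G -> Prop),
  (forall i j d d', D d -> D d' -> q i ** d = q j ** d' -> i = j) ->
  fin Al -> fin H ->
  (forall h, H h -> 4 * k <= #|[set i | `[< Al (h ** q i) >]]|) ->
  exists J : G -> Prop, [/\ (forall x, J x -> Al x),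
    (forall c c', J c -> J c' -> D (c^-1 ** c') -> c = c'),
    (forall h, H h -> exists i, J (h ** q i)) &
    (forall h, #|[set i | `[< exists d, D d /\ J (h ** q i ** d) >]]| <= k)]].
Proof.
have [n [dD [dDinj dDP]]] := fin_enum finD.
have n0 : 0 < n by case: n dD dDinj dDP => // dD _ /(_ (gone G)) [/(_ D1) [[]]].
have [k [kk k0 arith]] := hitting_parameters kappa n0.
exists k; split=> // q Al H spr finAl finH Hal.
have [N [b [binj bP]]] := fin_enum finAl.
pose Qs x := exists i, x = q i.
have finQ : fin Qs by exact: fin_codom.
(* Besides [H], only the finitely many h for which some h q_i D meets [Al] need an event; for all
   others the last count is zero. *)
pose Ht h := H h \/ exists i d, D d /\ Al (h ** q i ** d).
have finHt : fin Ht.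
  apply: (@fin_sub _ _ (por H (pmul Al (pmul D (pinv Qs))))).
    move=> h [|[i [d [Dd ad]]]]; [by left|right].
    exists (h ** q i ** d), (d^-1 ** (q i)^-1); split=> //; last by rewrite !gnorm.
    by apply: pmulI; [exact: DV|rewrite /pinv ginvK; exists i].
  apply: fin_por => //; apply: fin_pmul => //; apply: fin_pmul => //.
  exact: fin_pinv.
have [M [e [einj eP]]] := fin_enum finHt.
(* With 1024 n labels, a neighbourhood of at most n sites contains a 0 with probability at most
   1/1024. *)
pose l := (n * 1024).-1; have lE : l.+1 = n * 1024 by rewrite /l; lia.
pose Omega := {ffun 'I_N -> 'I_l.+1}.
pose B h i : {set 'I_N} := [set t | `[< exists d, D d /\ b t = h ** q i ** d >]].
have BP h i t : reflect (exists d, D d /\ b t = h ** q i ** d) (t \in B h i).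
  by rewrite inE; apply: asboolP.
have cardB h i : #|B h i| <= n.
  rewrite -[n]card_ord.
  apply: (@card_le_rel _ _ _ (fun t a => b t = h ** q i ** dD a)).
    by move=> t /BP[d [/dDP[a ->] ->]]; exists a.
  by move=> x y a <- /binj ->.
have disB h i j : i != j -> [disjoint B h i & B h j].
  move=> ij; apply/pred0P => t /=; apply/negP => /andP[/BP[d [Dd E1]] /BP[d' [Dd' E2]]].
  move: ij; rewrite (spr i j d d' Dd Dd') ?eqxx //.
  by apply: (@gmulI _ h); rewrite -!gmulA -E1 -E2.
pose sc (m : 'I_M) : {set 'I_N} := \bigcup_i B (e m) i.
pose iso h i : {set Omega} :=
  [set f | `[< exists2 t, b t = h ** q i & f \in isolated l (B h i) t >]].
pose bad1 (m : 'I_M) : {set Omega} := if `[< H (e m) >] then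
  \bigcap_(i in [set i | `[< Al (e m ** q i) >]]) ~: iso (e m) i else set0.
(* More than k touched neighbourhoods means that some k+1 of them are touched; at most 2^(8k) index
   sets compete. *)
pose bad2 (m : 'I_M) : {set Omega} :=
  \bigcup_(Z : {set 'I_(8 * k)} | #|Z| == k.+1) \bigcap_(i in Z) touched l (B (e m) i).
have Bsc m i : B (e m) i \subset sc m by exact: bigcup_sup.
have diso h i : determined_on (B h i) (iso h i).
  move=> f g fg; rewrite !inE; apply: asbool_equiv_eq.
  suff sub (f1 g1 : Omega) : {in B h i, f1 =1 g1} ->
      (exists2 t, b t = h ** q i & f1 \in isolated l (B h i) t) ->
      exists2 t, b t = h ** q i & g1 \in isolated l (B h i) t.
    by split; apply: sub => // t tB; rewrite fg.
  move=> fg1 [t bt ft]; exists t => //.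
  rewrite -(determined_isolated _ fg1) //; apply/BP; exists (gone G).
  by rewrite gmulr1.
have dbig (U : {set 'I_N}) (P : pred 'I_(8 * k)) (A : 'I_(8 * k) -> {set Omega}) :
    (forall i, determined_on U (A i)) -> determined_on U (\bigcap_(i | P i) A i).
  move=> dA f g fg; apply/bigcapP/bigcapP => C i iP; move: (C i iP);
    by rewrite (dA i f g).
have dsub (U U' : {set 'I_N}) (A : {set Omega}) : U \subset U' -> determined_on U A -> determined_on U' A.
  by move=> UU' dA f g fg; apply: dA => t /(subsetP UU')/fg.
have dC (U : {set 'I_N}) (A : {set Omega}) : determined_on U A -> determined_on U (~: A).
  by move=> dA f g fg; rewrite !inE (dA f g).
have dbad m : determined_on (sc m) (bad1 m :|: bad2 m).
  have d1 : determined_on (sc m) (bad1 m).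
    rewrite /bad1; case: asboolP => _; last by move=> f g _; rewrite !inE.
    by apply: dbig => i; apply: dC; apply: dsub (Bsc m i) _.
  move=> f g fg; rewrite !inE (d1 f g fg); congr (_ || _).
  apply/bigcupP/bigcupP => -[Z Zk C]; exists Z => //; move: C;
    rewrite (dbig (sc m) _ _ _ f g) // => i; apply: dsub (Bsc m i) _;
    exact: determined_touched.
have o0 : 0 < #|Omega| by apply/card_gt0P; exists [ffun=> ord0].
have cardsc m : #|sc m| <= 8 * k * n.
  apply: leq_trans (card_bigcup_le _ _) _.
  apply: (@leq_trans (\sum_(i < 8 * k) n)); first by apply: leq_sum => i _.
  by rewrite sum_nat_const card_ord.
have deg t : #|[set m | t \in sc m]| <= 8 * k * n.
  have <- : #|{: 'I_(8 * k) * 'I_n}| = 8 * k * n by rewrite card_prod !card_ord.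
  apply: (@card_le_rel _ _ _ (fun m u => b t = e m ** q u.1 ** dD u.2)).
    move=> m; rewrite inE => /bigcupP[i _ /BP[d [/dDP[a ->] ->]]].
    by exists (i, a).
  by move=> x y u -> /gmulIr/gmulIr/einj.
have card1 m : #|bad1 m| * (2 * (n * 1024)) ^ (4 * k) <=
    (2 * (n * 1024)).-1 ^ (4 * k) * #|Omega|.
  rewrite /bad1; case: asboolP => [Hm|_]; last by rewrite cards0.
  set Z := [set i | _]; have Zk : 4 * k <= #|Z| by exact: Hal.
  have bnd i : i \in Z ->
      #|~: iso (e m) i| * (2 * (n * 1024)) <= (2 * (n * 1024)).-1 * #|Omega|.
    rewrite inE => /asboolP/bP[t bt].
    have tB : t \in B (e m) i by apply/BP; exists (gone G); rewrite gmulr1.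
    have Bl : 2 * #|B (e m) i| <= l.+1 by have := cardB (e m) i; lia.
    rewrite -lE; apply: leq_trans (card_isolatedC Bl tB).
    rewrite leq_mul2r subset_leq_card ?orbT //; apply/subsetP => f.
    rewrite !in_setC; apply: contra => ft; rewrite inE; apply/asboolP.
    by exists t.
  have := @card_bigcap_independent _ _ _ Z (B (e m)) (fun i => ~: iso (e m) i) _ _
    (fun i => dC _ _ (diso (e m) i)) (fun i j _ _ => @disB (e m) i j) bnd.
  set x := #|_|; set u := 2 * _; set v := u.-1; set o := #|Omega|.
  (* There may be more than 4k allowed sites; each surplus factor v/u is at most 1 and is
     discarded. *)
  have u0 : 0 < u ^ (#|Z| - 4 * k) by rewrite expn_gt0 /u; lia.
  have vu : v ^ (#|Z| - 4 * k) <= u ^ (#|Z| - 4 * k).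
    by case: (#|Z| - 4 * k) => // r; rewrite leq_exp2r // /v leq_pred.
  rewrite -[in X in X -> _](subnK Zk) (expnD u) (expnD v); move: u0 vu.
  move: (u ^ (_ - _)) (v ^ (_ - _)) (u ^ (4 * k)) (v ^ (4 * k)) => u1 v1 u2 v2 u0 vu C.
  rewrite -(leq_pmul2r u0) -mulnA (mulnC u2); apply: leq_trans C _.
  by rewrite -[leqRHS]mulnA (mulnC o) mulnA leq_mul2r (mulnC v2) leq_mul2r vu !orbT.
have card2 m : #|bad2 m| * 1024 ^ k.+1 <= 2 ^ (8 * k) * #|Omega|.
  have card_one (Z : {set 'I_(8 * k)}) : #|Z| == k.+1 ->
      #|\bigcap_(i in Z) touched l (B (e m) i)| * 1024 ^ k.+1 <= #|Omega|.
    move=> /eqP Zk.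
    have bnd i : i \in Z -> #|touched l (B (e m) i)| * (n * 1024) <= n * #|Omega|.
      move=> _; rewrite -lE; apply: leq_trans (card_touched _ _) _.
      by rewrite leq_mul2r cardB orbT.
    have := @card_bigcap_independent _ _ _ Z (B (e m)) (fun i => touched l (B (e m) i)) _ _
      (fun i => @determined_touched _ l (B (e m) i)) (fun i j _ _ => @disB (e m) i j) bnd.
    rewrite Zk expnMn mulnCA leq_pmul2l // expn_gt0 n0 //.
  have := card_bigcup_le (fun Z : {set 'I_(8 * k)} => #|Z| == k.+1)
    (fun Z => \bigcap_(i in Z) touched l (B (e m) i)).
  rewrite -(@leq_pmul2r (1024 ^ k.+1)); last by rewrite expn_gt0.
  move=> H1; apply: leq_trans H1 _; rewrite big_distrl /=.
  apply: (@leq_trans (\sum_(Z : {set 'I_(8 * k)} | #|Z| == k.+1) #|Omega|)).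
    by apply: leq_sum => Z; exact: card_one.
  rewrite sum_nat_const leq_mul2r; apply/orP; right.
  apply: leq_trans (max_card _) _.
  by rewrite -cardsT -powersetT card_powerset cardsT card_ord.
have [f fgood] : exists f : Omega, forall m, f \notin bad1 m :|: bad2 m.
  have s0 : 0 < 8 * k * n by rewrite !muln_gt0 k0 n0.
  apply: (local_lemma s0 s0 o0 dbad cardsc deg) => m.
  apply: leq_trans (arith _ _ _ (card1 m) (card2 m)).
  by rewrite leq_mul2l leq_card_setU orbT.
pose J x := exists t, [/\ b t = x, f t = ord0 &
  forall s, D ((b t)^-1 ** b s) -> f s = ord0 -> s = t].
have JAl x : J x -> Al x by move=> [t [<- _ _]]; apply/bP; exists t.
exists J; split=> //.
- move=> _ _ [t [<- ft tiso]] [s [<- fs _]] Dts.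
  by rewrite (tiso s).
- move=> h Hh; apply: contrapT => noJ.
  have [m hm] : exists m, h = e m by apply/eP; left.
  have := fgood m; rewrite inE negb_or => /andP[/negP + _]; apply.
  rewrite /bad1 -hm; case: asboolP => // _; apply/bigcapP => i _.
  rewrite in_setC; apply/negP; rewrite inE => /asboolP[t bt].
  rewrite inE => /andP[/eqP ft /forallP tiso]; apply: noJ; exists i, t.
  split=> // s Ds fs; have := tiso s; rewrite fs eqxx /=.
  have -> : s \in B h i; last by move=> /eqP.
  by apply/BP; exists ((b t)^-1 ** b s); split=> //; rewrite -bt !gnorm.
- move=> h; rewrite leqNgt; apply/negP => /exists_subset_card[Z Zsub /eqP Zk].
  have [i0 i0Z] : exists i, i \in Z by apply/card_gt0P; rewrite (eqP Zk).
  have [m hm] : exists m, h = e m.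
    apply/eP; right; exists i0.
    have := subsetP Zsub _ i0Z; rewrite inE => /asboolP[d [Dd Jd]].
    by exists d; split=> //; apply: JAl.
  have := fgood m; rewrite inE negb_or => /andP[_ /negP]; apply.
  apply/bigcupP; exists Z => //; apply/bigcapP => i iZ.
  have := subsetP Zsub _ iZ; rewrite !inE => /asboolP[d [Dd [t [bt ft _]]]].
  apply/existsP; exists t; rewrite ft eqxx andbT.
  by apply/BP; exists d; rewrite -hm.
Qed.
End Hitting.

(** * Gluing classes of finite patterns *)

Section MoreFacts.
Variable G : Group.
Implicit Types (A B : G -> Prop).

(** If all coincidences involve the index k, then either i = k, or j = k and i is determined by d in
    [D]. The resulting bound |D| + 1 does not depend on m, so m may be chosen after it. *)
Lemma generic_points (D : G -> Prop) : icc G -> (exists d, d <> gone G) ->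
  fin D -> D (gone G) -> (forall d, D d -> D d^-1) ->
  exists kappa, forall m, exists q : 'I_m -> G,
    (forall i j d d', D d -> D d' -> q i ** d = q j ** d' -> i = j) /\
    (forall g, g <> gone G ->
      #|[set i | `[< exists j d, D d /\ q i = g ** q j ** d >]]| <= kappa).
Proof.
move=> iccG ntG finD D1 DV.
have [n [dD [dDinj dDP]]] := fin_enum finD.
exists n.+1 => m; have [q [spr gen]] := generic_sequence iccG ntG finD DV m.
have qinj (i j : 'I_m) : q i = q j -> i = j.
  by move=> E; apply/val_inj/(spr _ _ _ _ (ltn_ord i) (ltn_ord j) D1 D1); rewrite E.
exists (fun i => q i); split=> [i j d d' Dd Dd' E|g g1].
  by apply/val_inj/(spr _ _ _ _ (ltn_ord i) (ltn_ord j) Dd Dd').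
have [k kP] := gen g g1.
pose A1 := [set i : 'I_m | `[< exists d, D d /\ q i = g ** q k ** d >]].
have cardA1 : #|A1| <= n.
  rewrite -[n]card_ord.
  apply: (@card_le_rel _ _ _ (fun i a => q (val i) = g ** q k ** dD a)).
    by move=> i; rewrite inE => /asboolP[d [/dDP[a ->] ->]]; exists a.
  by move=> i j a <- /qinj ->.
have cardA0 : #|[set i : 'I_m | val i == k]| <= 1.
  apply/card_le1_eqP => i j; rewrite !inE => /eqP ik /eqP jk.
  by apply: val_inj; rewrite ik jk.
apply: (@leq_trans #|[set i : 'I_m | val i == k] :|: A1|).
  apply: subset_leq_card; apply/subsetP => i; rewrite !inE => /asboolP[j [d [Dd E]]].
  have [ik|jk] := kP _ _ _ (ltn_ord i) (ltn_ord j) Dd E.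
    by apply/orP; left; apply/eqP.
  by apply/orP; right; apply/asboolP; exists d; rewrite -jk.
by apply: leq_trans (leq_card_setU _ _) _; rewrite -add1n leq_add.
Qed.

(** Greedy: each point of the list is kept unless it is [Y]-close to one already kept. *)
Lemma maximal_separated (Y A : G -> Prop) : fin A -> Y (gone G) ->
  (forall y, Y y -> Y y^-1) -> exists M : G -> Prop, [/\ (forall x, M x -> A x),
    (forall x y, M x -> M y -> Y (x^-1 ** y) -> x = y) &
    (forall x, A x -> exists y, M y /\ Y (x^-1 ** y))].
Proof.
move=> [l lA] Y1 YV.
suff [M [MA Msep Mmax]] : exists M : G -> Prop, [/\ (forall x, M x -> A x),
    (forall x y, M x -> M y -> Y (x^-1 ** y) -> x = y) &
    (forall x, List.In x l -> A x -> exists y, M y /\ Y (x^-1 ** y))].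
  by exists M; split=> // x Ax; apply: Mmax => //; apply: lA.
elim: l {lA} => [|a l [M [MA Msep Mmax]]]; first by exists (fun=> False).
have [no|yes] := pselect (A a /\ forall y, M y -> ~ Y (a^-1 ** y)); last first.
  exists M; split=> // x [<- Ax|]; last exact: Mmax.
  apply: contrapT => H; apply: yes; split=> // y My Yy.
  by apply: H; exists y.
case: no => Aa noY.
exists (fun x => M x \/ x = a); split.
- by move=> x [/MA|->].
- move=> x y [Mx|->] [My|->] // Yxy; first exact: Msep.
    by case: (noY x Mx); rewrite -(ginvK x) -ginvM; apply: YV.
  by case: (noY y My).
- move=> x [<- _|xl Ax]; first by exists a; rewrite gmulV; split; [right|].
  by have [y [My Yy]] := Mmax x xl Ax; exists y; split; [left|].
Qed.
End MoreFacts.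

Section Systems.
Variable G : Group.

Definition config := G -> nat -> 'I_3.
Definition shift (T : Type) (g : G) (p : G -> T) : G -> T := fun x => p (g^-1 ** x).
Definition agree_upto n (a b : nat -> 'I_3) := forall j, j < n -> a j = b j.

(* This replaces strong irreducibility of a subshift: only patterns of the class
   S are glued, and the fixed reach R lets the next class control where the glued
   pattern can interfere with its own constraints. *)
Record system n (S : (G -> Prop) -> config -> Prop) (K R : G -> Prop) : Prop := System {
  sysK : fin K;
  sysK1 : K (gone G);
  sysKV : forall x, K x -> K x^-1;
  sysR : fin R;
  sysR1 : R (gone G);
  sys_fin : forall E p, S E p -> fin E;
  sys_shift : forall g E p, S E p -> S (shift g E) (shift g p);
  sys_agree : forall E p p', S E p -> (forall x, E x -> agree_upto n (p x) (p' x)) -> S E p';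
  sys_ext : forall (F : G -> Prop) (I : Type) (E : I -> G -> Prop) (p : I -> config),
    fin F -> (forall i, S (E i) (p i)) -> fin (fun x => exists i, E i x) ->
    (forall i j x y, E i x -> E j y -> K (x^-1 ** y) -> i = j) ->
    exists E' p', [/\ S E' p', forall x, F x -> E' x,
      forall i x, E i x -> E' x /\ agree_upto n (p' x) (p i x) &
      forall x, E' x -> pmul (fun a => F a \/ exists i, E i a) R x] }.

Lemma system_cover n S K R (F : G -> Prop) : system n S K R -> fin F ->
  exists E p, S E p /\ forall x, F x -> E x.
Proof.
move=> sys finF.
have [|||E [p [SE FE _ _]]] := sys_ext sys (F := F) (E := fun i : False => match i with end)
  (p := fun i : False => match i with end) finF; try by case.
  by exists nil => x [[]].
by exists E, p.
Qed.

(** Agreement on no coordinates is vacuous, so a gluing may be filled with an arbitrary constant. *)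
Lemma base_system : system 0 (fun E _ => fin E) (psing (gone G)) (psing (gone G)).
Proof.
split; rewrite /psing //.
- exact: fin_psing.
- by move=> x ->; rewrite ginv1.
- exact: fin_psing.
- move=> g E p finE; apply: fin_sub (fin_pmul (fin_psing g) finE) => x Ex.
  by exists g, (g^-1 ** x); split; rewrite // gmulKV.
- move=> F I E p finF _ finE _; exists (por F (fun x => exists i, E i x)), (fun _ _ => ord0).
  split=> //; [exact: fin_por|by left|by move=> i x Ex; split=> //; right; exists i|].
  by move=> x Hx; exists x, (gone G); rewrite gmulr1.
Qed.

Lemma third_colour (a b : 'I_3) : exists c : 'I_3, c <> a /\ c <> b.
Proof.
have : 0 < #|~: [set a; b]|.
  have := cardsC [set a; b]; rewrite card_ord.
  by have := cards2 a b; case: (a != b) => /=; lia.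
case/card_gt0P => c; rewrite !inE negb_or => /andP[/eqP ca /eqP cb].
by exists c.
Qed.

(** Greedy: a point a has only the neighbours a s and a s^-1, so one of three colours is free; s <>
    1 rules out loops. *)
Lemma extend_colouring (s : G) (l : list G) (U : G -> Prop) (c : G -> 'I_3) :
  s <> gone G -> (forall x, U x -> U (x ** s) -> c x <> c (x ** s)) ->
  exists c' : G -> 'I_3, (forall x, U x -> c' x = c x) /\
    forall x, U x \/ List.In x l -> U (x ** s) \/ List.In (x ** s) l -> c' x <> c' (x ** s).
Proof.
move=> s1; elim: l U c => [|a l IH] U c proper.
  by exists c; split=> // x [Ux|[]] [Uxs|[]]; apply: proper.
have [Ua|nUa] := pselect (U a).
  have [c' [c'c c'P]] := IH U c proper; exists c'; split=> // x Hx Hxs.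
  by apply: c'P; [case: Hx => [|[<-|]]|case: Hxs => [|[<-|]]]; try (by left); right.
have [k [k1 k2]] := third_colour (c (a ** s)) (c (a ** s^-1)).
pose c1 x := if `[< x = a >] then k else c x.
have c1a : c1 a = k by rewrite /c1; case: asboolP.
have c1n x : x <> a -> c1 x = c x by rewrite /c1; case: asboolP.
have [x|c' [c'c c'P]] := IH (fun x => U x \/ x = a) c1.
  have xs : x ** s <> x by move=> E; apply: s1; apply: (@gmulI _ x); rewrite gmulr1.
  have [->|xa] := pselect (x = a).
    move=> _; have [E|xsa] := pselect (a ** s = a).
      by case: s1; apply: (@gmulI _ a); rewrite gmulr1.
    by rewrite c1a (c1n _ xsa) => _; exact: k1.
  case=> // Ux; rewrite (c1n _ xa).
  have [E _|xsa [|//]] := pselect (x ** s = a); last first.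
    by rewrite (c1n _ xsa); exact: proper.
  by rewrite E c1a; have -> : x = a ** s^-1 by [rewrite -E !gnorm]; exact/nesym.
exists c'; split=> [x Ux|x Hx Hxs].
  by rewrite c'c ?c1n; [|move=> E; apply: nUa; rewrite -E|left].
apply: c'P.
  by case: Hx => [Ux|[<-|xl]]; [left; left|left; right|right].
by case: Hxs => [Ux|[<-|xl]]; [left; left|left; right|right].
Qed.

(** The guard is needed because an enumeration of the group also reaches the identity, for which no
    colouring is proper. *)
Definition proper_at n (s : G) (E : G -> Prop) (p : config) : Prop :=
  s <> gone G -> forall x, E x -> E (x ** s) -> p x n <> p (x ** s) n.

(** With s and s^-1 in the separation set, no edge x, x s joins two different pieces, so their
    colourings form one proper colouring to be extended. The domain is the old one, hence the same
    reach. *)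
Lemma add_coordinate n S K R (s : G) : system n S K R ->
  system n.+1 (fun E p => S E p /\ proper_at n s E p)
    (por K (por (psing s) (psing s^-1))) R.
Proof.
move=> sys; split.
- apply: fin_por (sysK sys) _; apply: fin_por; exact: fin_psing.
- by left; apply: sysK1 sys.
- move=> x [/(sysKV sys)|[->|->]]; [by left|by right; right|].
  by right; left; rewrite /psing ginvK.
- exact: sysR sys.
- exact: sysR1 sys.
- by move=> E p [SE _]; exact: (sys_fin sys SE).
- move=> g E p [SE prop]; split; first exact: (sys_shift sys).
  by move=> s1 x; rewrite /shift gmul_assoc; apply: prop.
- move=> E p p' [SE prop] pp'; split.
    by apply: (sys_agree sys SE) => // x Ex j jn; apply: pp' => //; apply: ltnW.
  by move=> s1 x Ex Exs; rewrite -!pp' //; apply: prop.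
move=> F I E p finF SE finE sep.
have [E' [p' [SE' FE' EE' E'R]]] := sys_ext sys finF (fun i => proj1 (SE i)) finE
  (fun i j x y Ex Ey Kxy => sep i j x y Ex Ey (or_introl Kxy)).
pose U x := exists i, E i x.
have /choice [c0 c0P] x : exists a : 'I_3, forall i, E i x -> p i x n = a.
  have [[i Eix]|no] := pselect (U x); last first.
    by exists ord0 => i Eix; case: no; exists i.
  exists (p i x n) => j Ejx; rewrite (sep i j x x) // gmulV.
  by left; apply: sysK1 sys.
have [l lE'] := sys_fin sys SE'.
have [c [cE cproper]] : exists c : G -> 'I_3, (forall x, U x -> c x = c0 x) /\
    (s <> gone G -> forall x, E' x -> E' (x ** s) -> c x <> c (x ** s)).
  have [->|s1] := pselect (s = gone G); first by exists c0.
  have [|c [cU cP]] := @extend_colouring s l U c0 s1.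
    move=> x [i Ex] [j Exs]; rewrite -(c0P x i Ex) -(c0P _ j Exs).
    have ij : i = j by apply: sep Ex Exs _; right; left; rewrite /psing gmulVK.
    by rewrite -ij; apply: (proj2 (SE i)) => //; rewrite ij.
  by exists c; split=> // _ x /lE' Ex /lE' Exs; apply: cP; right.
exists E', (fun x j => if j == n then c x else p' x j); split=> //.
- split; last by move=> s1 x Ex Exs; rewrite /= eqxx; apply: cproper.
  by apply: (sys_agree sys SE') => // x _ j jn; rewrite ltn_eqF.
- move=> i x Ex; have [E'x agr] := EE' i x Ex; split=> // j.
  rewrite ltnS leq_eqVlt => /predU1P[->|jn]; last by rewrite ltn_eqF // agr.
  by rewrite eqxx cE ?(c0P _ i) //; exists i.
Qed.
End Systems.

(** * One step: forcing agreement on a translate of a finite set *)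

Section ProximalStep.
Variables (G : Group) (n : nat) (S : (G -> Prop) -> config G -> Prop) (K R : G -> Prop).
Hypothesis sys : system n S K R.
Variables (E0 : G -> Prop) (p0 : config G).
Hypotheses (SE0 : S E0 p0) (E01 : E0 (gone G)).

Definition placed (E : G -> Prop) (p : config G) (c : G) : Prop :=
  forall z, E0 z -> E (c ** z) /\ agree_upto n (p (c ** z)) (p0 z).

Let KE := pmul K (pinv E0).
(** Centres c for which c E0 contains a point of E K; at any other centre a copy of the pattern can
    be glued to E. *)
Definition meets (E : G -> Prop) : G -> Prop := pmul E KE.
Let N := pmul R KE.
Let D0 := pmul E0 N.
(** The symmetrised set E0 R K E0^-1. Copies whose centres do not differ by it stay K-separated even
    after gluing has thickened one of them by R. *)
Definition step_dist : G -> Prop := por D0 (pinv D0).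
Local Notation D := step_dist.

Let finE0 : fin E0. Proof. exact: (sys_fin sys SE0). Qed.
Let finKE : fin KE. Proof. by apply: fin_pmul (fin_pinv finE0); exact: sysK sys. Qed.
Let finN : fin N. Proof. by apply: fin_pmul finKE; exact: sysR sys. Qed.
Let KE1 : KE (gone G).
Proof.
exists (gone G), (gone G); split; rewrite ?gmul1 //; first exact: sysK1 sys.
by rewrite /pinv ginv1.
Qed.
Let KEN x : KE x -> N x.
Proof. by move=> Kx; exists (gone G), x; split; rewrite ?gmul1 //; exact: sysR1 sys. Qed.

Lemma fin_step_dist : fin D.
Proof.
have finD0 : fin D0 by apply: fin_pmul.
by apply: fin_por finD0 (fin_pinv finD0).
Qed.
Lemma step_dist1 : D (gone G).
Proof. by left; exists (gone G), (gone G); split; rewrite ?gmul1 //; apply: KEN. Qed.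
Lemma step_distV d : D d -> D d^-1.
Proof. by case=> [H|H]; [right; rewrite /pinv ginvK|left]. Qed.
Let D1 := step_dist1.
Let DV := step_distV.

Variables (k kappa : nat) (q : 'I_(8 * k) -> G).
Hypotheses (kk : kappa <= k) (k0 : 0 < k).
Hypothesis q_spread : forall i j d d', D d -> D d' -> q i ** d = q j ** d' -> i = j.
Hypothesis q_generic : forall g, g <> gone G ->
  #|[set i | `[< exists j d, D d /\ q i = g ** q j ** d >]]| <= kappa.
Hypothesis q_hitting : forall Al H : G -> Prop, fin Al -> fin H ->
  (forall h, H h -> 4 * k <= #|[set i | `[< Al (h ** q i) >]]|) ->
  exists J : G -> Prop, [/\ (forall x, J x -> Al x),
    (forall c c', J c -> J c' -> D (c^-1 ** c') -> c = c'),
    (forall h, H h -> exists i, J (h ** q i)) &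
    (forall h, #|[set i | `[< exists d, D d /\ J (h ** q i ** d) >]]| <= k)].

Let Qs x := exists i, x = q i.
(** m Q and m' Q contain centres differing by [D] exactly when m^-1 m' lies in this set. *)
Definition step_diff : G -> Prop := pmul Qs (pmul D (pinv Qs)).
Local Notation B := step_diff.
Let finQs : fin Qs. Proof. exact: fin_codom. Qed.
Let Qi i : Qs (q i). Proof. by exists i. Qed.
Let i0 : 'I_(8 * k). Proof. by apply: (@Ordinal _ 0); rewrite muln_gt0 k0. Qed.
Let Bi i j d : D d -> B (q i ** (d ** (q j)^-1)).
Proof. by move=> Dd; apply: pmulI => //; apply: pmulI => //; rewrite /pinv ginvK. Qed.
Lemma fin_step_diff : fin B.
Proof.
apply: fin_pmul => //; apply: fin_pmul; [exact: fin_step_dist|exact: fin_pinv].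
Qed.
Let finB := fin_step_diff.
Let BV x : B x -> B x^-1.
Proof.
move=> [_ [y [[i ->] [d [z [Dd [j zj] ->]]] ->]]].
have -> : z = (q j)^-1 by rewrite -zj ginvK.
by have := Bi j i (DV Dd); rewrite !gnorm.
Qed.
Let B1 : B (gone G). Proof. by have := Bi i0 i0 D1; rewrite !gnorm. Qed.

Variable W0 : G -> Prop.
Hypotheses (finW0 : fin W0) (W01 : W0 (gone G)).
Hypothesis W0_avoids : forall g, exists w, W0 w /\ ~ B (g^-1 ** w).

(** Two distinct points of a [Y]-separated net never lie in a common h W0 B. *)
Let Y := pmul B (pmul (pinv W0) (pmul W0 B)).
Definition step_net : G -> Prop := pmul W0 Y.
Local Notation W := step_net.
Let Z := pmul W0 Qs.
Let finY : fin Y.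
Proof. by apply: fin_pmul => //; apply: fin_pmul; [exact: fin_pinv|exact: fin_pmul]. Qed.
Let Yi b w w' b' : B b -> W0 w -> W0 w' -> B b' -> Y (b ** (w^-1 ** (w' ** b'))).
Proof.
by move=> *; apply: pmulI => //; apply: pmulI; [rewrite /pinv ginvK|apply: pmulI].
Qed.
Let YV y : Y y -> Y y^-1.
Proof.
move=> [b [_ [Bb [v [_ [Wv [w' [b' [Ww' Bb' ->]]] ->]]] ->]]].
by have := Yi (BV Bb') Ww' Wv (BV Bb); rewrite !gnorm.
Qed.
Let Y1 : Y (gone G). Proof. by have := Yi B1 W01 W01 B1; rewrite !gnorm. Qed.
Let BY b : B b -> Y b.
Proof. by move=> Bb; have := Yi B1 W01 W01 Bb; rewrite !gnorm. Qed.
Lemma fin_step_net : fin W. Proof. exact: fin_pmul. Qed.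

(* The alternatives "few sites are met" and "some h w Q is missed" leave room to
   complete a pattern of the class near its boundary; they are void in the middle
   of a large pattern, so there every h Q is hit and some h w Q is filled. *)
Definition step_class (E : G -> Prop) (p : config G) : Prop :=
  [/\ S E p,
   forall h, (exists i, placed E p (h ** q i)) \/
     #|[set i | `[< meets E (h ** q i) >]]| <= 2 * k &
   forall h, (exists w, W w /\ forall i, placed E p (h ** w ** q i)) \/
     (exists w, W0 w /\ forall i, ~ meets E (h ** w ** q i))].

(** Chosen so that the sites of a single h W0 Q can meet at most one of the pieces to be glued. *)
Definition step_sep : G -> Prop := pmul KE (pmul (pinv Z) (pmul Z (pinv KE))).
Local Notation K' := step_sep.
Let V2 := pmul N (pmul (pinv Qs) Qs).
Let V1 := pmul V2 (pmul D (pmul (pinv Qs) (pmul (pinv W0) (pmul W0 Qs)))).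
(** [V2] accounts for the hitting sites, [V1] for the completely filled translates, and E0 R for the
    copies around these centres and the old reach. *)
Definition step_reach : G -> Prop := por R (pmul (por V1 V2) (pmul E0 R)).
Local Notation R' := step_reach.

Let K'i a z z' b : KE a -> Z z -> Z z' -> KE b -> K' (a ** (z^-1 ** (z' ** b^-1))).
Proof.
move=> *; apply: pmulI => //; apply: pmulI; first by rewrite /pinv ginvK.
by apply: pmulI; rewrite // /pinv ginvK.
Qed.
Let Zi w i : W0 w -> Z (w ** q i). Proof. by move=> ?; apply: pmulI. Qed.
Let K'V x : K' x -> K' x^-1.
Proof.
move=> [a [_ [Ka [v [_ [Zv [z [b [Zz Kb ->]]] ->]]] ->]]].
by have := K'i Kb Zz Zv Ka; rewrite !gnorm.
Qed.
Let KK' x : K x -> K' x.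
Proof.
move=> Kx; have KEx : KE x.
  by exists x, (gone G); split; rewrite ?gmulr1 // /pinv ginv1.
by have := K'i KEx (Zi i0 W01) (Zi i0 W01) KE1; rewrite !gnorm.
Qed.

Let placed_shift g E p c : placed (shift g E) (shift g p) c <-> placed E p (g^-1 ** c).
Proof. by rewrite /placed /shift; split=> H z /H; rewrite gmul_assoc. Qed.
Let meets_shift g E x : meets (shift g E) x <-> meets E (g^-1 ** x).
Proof.
split=> [[a [b [Ea Kb ->]]]|[a [b [Ea Kb E1]]]].
  by exists (g^-1 ** a), b; rewrite gmul_assoc.
by exists (g ** a), b; split; rewrite ?/shift ?gmulVK // gmulA -E1 gmulKV.
Qed.
Let placed_agree E p p' c : (forall x, E x -> agree_upto n (p x) (p' x)) ->
  placed E p c -> placed E p' c.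
Proof.
move=> pp' pl z /pl[Ez agr]; split=> // j jn.
by rewrite -(pp' _ Ez j jn) agr.
Qed.

(** * Gluing a separated family within the new class *)

Section Extension.
Variables (F : G -> Prop) (I : Type) (E_ : I -> G -> Prop) (p_ : I -> config G).
Hypotheses (finF : fin F) (SE : forall i, step_class (E_ i) (p_ i)).
Hypothesis finE : fin (fun x => exists i, E_ i x).
Hypothesis sep : forall i j x y, E_ i x -> E_ j y -> K' (x^-1 ** y) -> i = j.

Let AA a := F a \/ exists i, E_ i a.
Let TF x := exists i, meets (E_ i) x.
Let CF x := exists i, placed (E_ i) (p_ i) x.
Let finAA : fin AA. Proof. exact: fin_por. Qed.

Let near i j h z z' : meets (E_ i) (h ** z) -> meets (E_ j) (h ** z') -> Z z -> Z z' -> i = j.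
Proof.
move=> [x [a [Ex Ka E1]]] [y [b [Ey Kb E2]]] Zz Zz'; apply: (sep Ex Ey).
have -> : x^-1 ** y = a ** (z^-1 ** (z' ** b^-1)); last exact: K'i.
have -> : x = h ** z ** a^-1 by rewrite E1 !gnorm.
have -> : y = h ** z' ** b^-1 by rewrite E2 !gnorm.
by rewrite !gnorm.
Qed.

(** By [near], h Q meets at most one piece, so the condition of that piece passes to the whole
    family. *)
Let hit_or_few h : (exists t, CF (h ** q t)) \/ #|[set t | `[< TF (h ** q t) >]]| <= 2 * k.
Proof.
have [->|[t]] := set_0Vmem [set t | `[< TF (h ** q t) >]]; first by right; rewrite cards0.
rewrite inE => /asboolP[i Ti].
have [_ /(_ h) [[s Cs]|few] _] := SE i; first by left; exists s, i.
right; apply: leq_trans few; apply: subset_leq_card; apply/subsetP => s.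
rewrite !inE => /asboolP[j Tj]; apply/asboolP.
have <- // : j = i.
by apply: (near (h := h) Tj Ti); [have := Zi s W01|have := Zi t W01]; rewrite gmul1.
Qed.

Let full_or_free h : (exists w, W w /\ forall t, CF (h ** w ** q t)) \/
  (exists w, W0 w /\ forall t, ~ TF (h ** w ** q t)).
Proof.
have [[w [t [Ww [i Ti]]]]|no] := pselect (exists w t, W0 w /\ TF (h ** w ** q t)); last first.
  by right; exists (gone G); split=> // t Tt; apply: no; exists (gone G), t.
have [_ _ /(_ h) [[v [Wv Cv]]|[v [Wv Tv]]]] := SE i.
  by left; exists v; split=> // s; exists i.
right; exists v; split=> // s [j Tj]; apply: (Tv s); have <- // : j = i.
by apply: (near (h := h) (z := v ** q s) (z' := w ** q t)); rewrite ?gmul_assoc //; exact: Zi.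
Qed.

(** [X1] confines the hitting sites. [H1] collects the h whose h Q enters the zone reached by gluing
    around [AA], [H2] those with some h W0 Q near [X1], and [Gs] the translates that are free to be
    filled completely. *)
Let X1 := pmul AA V2.
Let H1 h := exists t, pmul AA N (h ** q t).
Let H2 h := exists w t, W0 w /\ pmul X1 D (h ** w ** q t).
Let Gs g := (exists h w, [/\ H2 h, W0 w & g = h ** w]) /\ forall t, ~ TF (g ** q t).

Let finV2 : fin V2.
Proof. by apply: fin_pmul => //; apply: fin_pmul => //; apply: fin_pinv. Qed.
Let finX1 : fin X1. Proof. exact: fin_pmul. Qed.
Let finH1 : fin H1.
Proof.
apply: (@fin_sub _ _ (pmul (pmul AA N) (pinv Qs))).
  move=> h [t Ht]; exists (h ** q t), (q t)^-1; split=> //; last by rewrite !gnorm.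
  by rewrite /pinv ginvK.
by apply: fin_pmul; [exact: fin_pmul|exact: fin_pinv].
Qed.
Let finGs : fin Gs.
Proof.
apply: (@fin_sub _ _ (pmul (pmul (pmul X1 D) (pinv Z)) W0)).
  move=> _ [[h [w [[v [t [Wv Ht]]] Ww ->]]] _]; exists h, w; split=> //.
  exists (h ** v ** q t), (v ** q t)^-1; split=> //; last by rewrite !gnorm.
  by rewrite /pinv ginvK; apply: Zi.
apply: fin_pmul => //; apply: fin_pmul; first by apply: fin_pmul => //; exact: fin_step_dist.
by apply: fin_pinv; apply: fin_pmul.
Qed.

Let AAN_X1 x : pmul AA N x -> X1 x.
Proof.
move=> [a [m [Aa Nm ->]]]; exists a, (m ** ((q i0)^-1 ** q i0)).
split=> //; last by rewrite !gnorm.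
by apply: pmulI => //; apply: pmulI => //; rewrite /pinv ginvK.
Qed.
Let X1_X1D x : X1 x -> pmul X1 D x.
Proof. by move=> Xx; exists x, (gone G); rewrite gmulr1. Qed.

Section WithNet.
Variable M : G -> Prop.
Hypothesis MGs : forall x, M x -> Gs x.
Hypothesis Msep : forall x y, M x -> M y -> Y (x^-1 ** y) -> x = y.
Hypothesis Mmax : forall x, Gs x -> exists y, M y /\ Y (x^-1 ** y).

Let MQ x := exists m t, M m /\ x = m ** q t.
Let finMQ : fin MQ.
Proof.
apply: (@fin_sub _ _ (pmul Gs Qs)); last exact: fin_pmul.
by move=> _ [m [t [/MGs Gm ->]]]; apply: pmulI.
Qed.

Let M_unique h m m' : M m -> M m' -> pmul W0 B (h^-1 ** m) -> pmul W0 B (h^-1 ** m') -> m = m'.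
Proof.
move=> Mm Mm' [w [b [Ww Bb E1]]] [w' [b' [Ww' Bb' E2]]]; apply: Msep => //.
have -> : m^-1 ** m' = b^-1 ** (w^-1 ** (w' ** b')).
  by rewrite -[m](gmulKV h) E1 -[m'](gmulKV h) E2 !gnorm.
by apply: Yi => //; apply: BV.
Qed.

Let MQD_near h w t : W0 w -> pmul MQ D (h ** w ** q t) ->
  exists m j d, [/\ M m, D d, h ** w ** q t = m ** q j ** d, pmul W0 B (h^-1 ** m) & B (m^-1 ** (h ** w))].
Proof.
move=> Ww [_ [d [[m [j [Mm ->]]] Dd E1]]]; exists m, j, d; split=> //.
  have -> : h^-1 ** m = w ** (q t ** (d^-1 ** (q j)^-1)).
    have -> : m = h ** w ** q t ** d^-1 ** (q j)^-1 by rewrite E1 !gnorm.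
    by rewrite !gnorm.
  by apply: pmulI => //; apply: Bi; apply: DV.
have -> : m^-1 ** (h ** w) = q j ** (d ** (q t)^-1); last exact: Bi.
have -> : h ** w = m ** q j ** d ** (q t)^-1 by rewrite -E1 !gnorm.
by rewrite !gnorm.
Qed.

(** By [M_unique] a single net point m is responsible for all these sites, and h^-1 m <> 1, so
    genericity of Q bounds their number. *)
Let card_MQD h : ~ M h -> #|[set t | `[< pmul MQ D (h ** q t) >]]| <= kappa.
Proof.
move=> nMh.
have [->|[t]] := set_0Vmem [set t | `[< pmul MQ D (h ** q t) >]]; first by rewrite cards0.
rewrite inE => /asboolP Ht.
have := @MQD_near h (gone G) t W01; rewrite gmulr1 => /(_ Ht) [m [_ [_ [Mm _ _ hm _]]]].
have hm1 : h^-1 ** m <> gone G.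
  by move=> E1; apply: nMh; rewrite -(gmulr1 h) -E1 gmulKV.
apply: leq_trans (q_generic hm1); apply: subset_leq_card; apply/subsetP => s.
rewrite !inE => /asboolP Hs; apply/asboolP.
have := @MQD_near h (gone G) s W01; rewrite gmulr1 => /(_ Hs) [m' [j [d [Mm' Dd E1 hm' _]]]].
exists j, d; split=> //; rewrite (M_unique Mm Mm' hm hm').
by rewrite !gmulA -(gmulA m') -E1 gmulVK.
Qed.

Let Al b := [/\ X1 b, ~ TF b & ~ pmul MQ D b].
Let H h := [/\ H1 h, ~ M h & ~ exists t, CF (h ** q t)].
Lemma fin_allowed : fin Al. Proof. by apply: fin_sub finX1 => x []. Qed.
Lemma fin_targets : fin H. Proof. by apply: fin_sub finH1 => x []. Qed.

Let H1_X1 h t : H1 h -> X1 (h ** q t).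
Proof.
move=> [s [a [m [Aa Nm E1]]]]; exists a, (m ** ((q s)^-1 ** q t)); split=> //.
  by apply: pmulI => //; apply: pmulI => //; rewrite /pinv ginvK.
have -> : h = a ** m ** (q s)^-1 by rewrite -E1 !gnorm.
by rewrite !gnorm.
Qed.

(** Of the 8k sites at most 2k meet a piece and at most kappa <= k are close to filled
    translates. *)
Lemma card_allowed h : H h -> 4 * k <= #|[set t | `[< Al (h ** q t) >]]|.
Proof.
move=> [Hh nMh nC]; have [//|few] := hit_or_few h; have few' := card_MQD nMh.
set A := [set t | _].
have sub : ~: A \subset [set t | `[< TF (h ** q t) >]] :|: [set t | `[< pmul MQ D (h ** q t) >]].
  apply/subsetP => t; rewrite !inE => /asboolPn nA; apply/orP.
  have [T|nT] := pselect (TF (h ** q t)); first by left; apply/asboolP.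
  right; apply/asboolP; apply: contrapT => nM; apply: nA; split=> //.
  exact: H1_X1.
have := leq_trans (subset_leq_card sub) (leq_card_setU _ _).
have := cardsC A; rewrite card_ord; lia.
Qed.

Variable Jh : G -> Prop.
Hypothesis JAl : forall x, Jh x -> Al x.
Hypothesis Jsep : forall c c', Jh c -> Jh c' -> D (c^-1 ** c') -> c = c'.
Hypothesis Jhit : forall h, H h -> exists i, Jh (h ** q i).
Hypothesis Jfew : forall h, #|[set i | `[< exists d, D d /\ Jh (h ** q i ** d) >]]| <= k.

Let J x := MQ x \/ Jh x.
Let finJ : fin J.
Proof. by apply: fin_por finMQ _; apply: fin_sub fin_allowed. Qed.
Let J_TF c : J c -> ~ TF c.
Proof. by case=> [[m [t [/MGs [_ nT] ->]]]|/JAl[]]. Qed.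

Let J_sep c c' : J c -> J c' -> D (c^-1 ** c') -> c = c'.
Proof.
have mixed x y : MQ x -> Jh y -> ~ D (x^-1 ** y).
  by move=> Mx /JAl[_ _ nM] Dxy; apply: nM; exists x, (x^-1 ** y); rewrite gmulKV.
case=> [Mc|Jc] [Mc'|Jc'] Dcc'.
- case: Mc Mc' Dcc' => [m [t [Mm ->]]] [m' [t' [Mm' ->]]] Dcc'.
  have mm' : m = m'.
    apply: Msep => //; apply: BY; have := Bi t t' Dcc'; by rewrite !gnorm.
  rewrite -mm' in Dcc' *; congr (_ ** q _); move: Dcc'; rewrite !gnorm => Dd.
  by symmetry; apply: (q_spread D1 Dd); rewrite !gnorm.
- by case: (mixed c c').
- by case: (mixed c' c) => //; have := DV Dcc'; rewrite !gnorm.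
- exact: Jsep.
Qed.

Let I2 : Type := (I + {c : G | J c})%type.
Let E2 (u : I2) : G -> Prop := match u with inl i => E_ i | inr c => shift (proj1_sig c) E0 end.
Let p2 (u : I2) : config G := match u with inl i => p_ i | inr c => shift (proj1_sig c) p0 end.

(** New centres avoid every site meeting a piece, and two of them differ by nothing in [D], which
    contains E0 K E0^-1 since 1 lies in R. *)
Let E2_sep u v x y : E2 u x -> E2 v y -> K (x^-1 ** y) -> u = v.
Proof.
have mixed i c a b : E_ i a -> J c -> E0 (c^-1 ** b) -> ~ K (a^-1 ** b).
  move=> Ea Jc Eb Kab; apply: (J_TF Jc); exists i, a, ((a^-1 ** b) ** (c^-1 ** b)^-1).
  split=> //; last by rewrite !gnorm.
  by apply: pmulI; rewrite // /pinv ginvK.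
case: u v => [i|[c Jc]] [j|[c' Jc']] /= Ex Ey Kxy.
- by congr inl; apply: sep Ex Ey _; apply: KK'.
- by case: (mixed i c' x y).
- by case: (mixed j c y x) => //; have := sysKV sys Kxy; rewrite !gnorm.
- have cc' : c = c'.
    apply: J_sep => //; left.
    have -> : c^-1 ** c' = (c^-1 ** x) ** (gone G ** ((x^-1 ** y) ** (c'^-1 ** y)^-1)).
      by rewrite !gnorm.
    apply: pmulI => //; apply: pmulI; first exact: sysR1 sys.
    by apply: pmulI; rewrite // /pinv ginvK.
  move: Jc Jc'; rewrite cc' => Jc Jc'; congr (inr (exist _ _ _)).
  exact: Prop_irrelevance.
Qed.

Let S2 u : S (E2 u) (p2 u).
Proof. by case: u => [i|[c Jc]] /=; [case: (SE i)|apply: sys_shift sys _ _ _ SE0]. Qed.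
Let finE2 : fin (fun x => exists u, E2 u x).
Proof.
apply: (@fin_sub _ _ (por (fun x => exists i, E_ i x) (pmul J E0))).
  move=> x [[i Ex|[c Jc] /= Ex]]; [by left; exists i|right].
  by exists c, (c^-1 ** x); rewrite gmulKV.
by apply: fin_por => //; apply: fin_pmul.
Qed.

Lemma extension_with_sites : exists E' p', [/\ step_class E' p', forall x, F x -> E' x,
  forall i x, E_ i x -> E' x /\ agree_upto n (p' x) (p_ i x) &
  forall x, E' x -> pmul AA R' x].
Proof.
have [E' [p' [SE' FE' EE' E'R]]] := sys_ext sys finF S2 finE2 E2_sep.
have placedJ c : J c -> placed E' p' c.
  move=> Jc z Ez; have [|E'z agr] := EE' (inr (exist _ c Jc)) (c ** z).
    by rewrite /= /shift gmulVK.
  by split=> //; move: agr; rewrite /= /shift gmulVK.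
have placedC c : CF c -> placed E' p' c.
  move=> [i pl] z /pl[Ez agr]; have [E'z agr'] := EE' (inl i) (c ** z) Ez.
  by split=> // j jn; rewrite agr' //; exact: agr.
(* Gluing spreads only by R, so whatever meets E' is felt either from [AA] or from a new centre. *)
have meetsE' x : meets E' x -> pmul AA N x \/ pmul J D x.
  move=> [y [a [E'y Ka ->]]].
  have [b [r [Hb Rr ->]]] := E'R y E'y.
  have Nra : N (r ** a) by apply: pmulI.
  have [Fb|[i Eb]|[[c Jc] /= Eb]] : [\/ F b, exists i, E_ i b | exists c : {c | J c}, E0 ((proj1_sig c)^-1 ** b)].
    by case: Hb => [Fb|[[i Eb|c Eb]]]; [constructor 1|constructor 2; exists i|constructor 3; exists c].
  - by left; exists b, (r ** a); rewrite gmul_assoc; split=> //; left.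
  - by left; exists b, (r ** a); rewrite gmul_assoc; split=> //; right; exists i.
  - right; exists c, ((c^-1 ** b) ** (r ** a)); split=> //; last by rewrite !gnorm.
    by left; apply: pmulI.
exists E', p'; split=> //.
- split=> // h.
  + have [Mh|nMh] := pselect (M h).
      by left; exists i0; apply: placedJ; left; exists h, i0.
    have [[t Ct]|nC] := pselect (exists t, CF (h ** q t)).
      by left; exists t; apply: placedC.
    have [Hh|nH] := pselect (H1 h).
      by have [|t Jt] := Jhit (h := h); [split|left; exists t; apply: placedJ; right].
    (* Away from [AA] only filled translates and hitting sites count: at most kappa + k <= 2k sites,
       which is the threshold in [step_class]. *)
    right; have few := card_MQD nMh; have few' := Jfew h.
    have sub : [set i | `[< meets E' (h ** q i) >]] \subset
        [set t | `[< pmul MQ D (h ** q t) >]] :|: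
        [set i | `[< exists d, D d /\ Jh (h ** q i ** d) >]].
      apply/subsetP => t; rewrite !inE => /asboolP /meetsE' [|[c [d [[Mc|Jc] Dd E1]]]].
      * by move=> AN; case: nH; exists t.
      * by apply/orP; left; apply/asboolP; exists c, d.
      * apply/orP; right; apply/asboolP; exists d^-1; split; first exact: DV.
        by rewrite E1 !gnorm.
    have := leq_trans (subset_leq_card sub) (leq_card_setU _ _); lia.
  + have [Hh|nH] := pselect (H2 h).
      have [[w [Ww Cw]]|[w [Ww Tw]]] := full_or_free h.
        by left; exists w; split=> // t; apply: placedC.
      (* The free translate at h w is a candidate for the net, so by maximality a net point lies in
         h w Y, within h W. *)
      have [|m [Mm Ym]] := Mmax (x := h ** w); first by split=> //; exists h, w.
      left; exists (w ** ((h ** w)^-1 ** m)); split; first exact: pmulI.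
      move=> t; apply: placedJ; left; exists m, t; split=> //; congr (_ ** _).
      by rewrite !gnorm.
    have noX w t : W0 w -> pmul X1 D (h ** w ** q t) -> False.
      by move=> Ww X; apply: nH; exists w, t.
    (* Outside [H2] only filled translates can interfere. At most one net point m is close to h, and
       some w in W0 keeps h w out of m B. *)
    right; have [w [Ww wP]] : exists w, W0 w /\ forall m, M m -> pmul W0 B (h^-1 ** m) -> ~ B (m^-1 ** (h ** w)).
      have [[m [Mm hm]]|no] := pselect (exists m, M m /\ pmul W0 B (h^-1 ** m)); last first.
        by exists (gone G); split=> // m Mm hm; case: no; exists m.
      have [w [Ww nB]] := W0_avoids (h^-1 ** m); exists w; split=> // m' Mm' hm'.
      by rewrite -(M_unique Mm Mm' hm hm'); move: nB; rewrite !gnorm.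
    exists w; split=> // t /meetsE' [/AAN_X1/X1_X1D|[c [d [[Mc|Jc] Dd E1]]]]; first exact: noX.
      have [|m [j [e [Mm _ _ hm Bm]]]] := @MQD_near h w t Ww; first by exists c, d.
      by case: (wP m).
    by apply: (noX w t) => //; exists c, d; split=> //; case: (JAl Jc).
- by move=> i x Ex; apply: (EE' (inl i)).
- move=> x /E'R [a [r [Ha Rr ->]]].
  have [Fb|[i Eb]|[[c Jc] /= Eb]] : [\/ F a, exists i, E_ i a | exists c : {c | J c}, E0 ((proj1_sig c)^-1 ** a)].
    by case: Ha => [Fb|[[i Eb|c Eb]]]; [constructor 1|constructor 2; exists i|constructor 3; exists c].
  + by apply: pmulI; [left|left].
  + by apply: pmulI; [right; exists i|left].
  have [b [v [Ab Vv cE]]] : pmul AA (por V1 V2) c.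
    case: Jc => [[m [t [/MGs [[h [w [Hh Ww ->]]] _] ->]]]|/JAl[[b [v [Ab Vv ->]]] _ _]]; last first.
      by exists b, v; split=> //; right.
    have [w' [t' [Ww' [_ [d [[b [v [Ab Vv ->]]] Dd E1]]]]]] := Hh.
    exists b, (v ** (d ** ((q t')^-1 ** (w'^-1 ** (w ** q t))))); split=> //.
      left; apply: pmulI => //; apply: pmulI => //; apply: pmulI; first by rewrite /pinv ginvK.
      by apply: pmulI; [rewrite /pinv ginvK|apply: pmulI].
    have -> : h = b ** v ** d ** (q t')^-1 ** w'^-1 by rewrite -E1 !gnorm.
    by rewrite !gnorm.
  exists b, (v ** ((c^-1 ** a) ** r)); split=> //; last by rewrite gmul_assoc -cE !gnorm.
  by right; apply: pmulI => //; apply: pmulI.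
Qed.
End WithNet.

Lemma step_extension : exists E' p', [/\ step_class E' p', forall x, F x -> E' x,
  forall i x, E_ i x -> E' x /\ agree_upto n (p' x) (p_ i x) &
  forall x, E' x -> pmul AA R' x].
Proof.
have [M [MGs Msep Mmax]] := maximal_separated finGs Y1 YV.
have [Jh [JAl Jsep Jhit Jfew]] := q_hitting (fin_allowed M) (fin_targets M) (card_allowed Msep).
exact: (extension_with_sites MGs Msep Mmax JAl Jsep Jhit Jfew).
Qed.
End Extension.

Lemma step_system : system n step_class K' R'.
Proof.
have finZ : fin Z by apply: fin_pmul.
have finV2' : fin V2.
  by apply: fin_pmul => //; apply: fin_pmul => //; apply: fin_pinv.
have finV1 : fin V1.
  apply: fin_pmul => //; apply: fin_pmul; first exact: fin_step_dist.
  apply: fin_pmul; first exact: fin_pinv.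
  by apply: fin_pmul; [exact: fin_pinv|exact: fin_pmul].
have finR := sysR sys.
split.
- apply: fin_pmul => //; apply: fin_pmul; first exact: fin_pinv.
  by apply: fin_pmul => //; apply: fin_pinv.
- by apply: KK'; exact: sysK1 sys.
- exact: K'V.
- apply: fin_por => //; apply: fin_pmul; first exact: fin_por.
  exact: fin_pmul.
- by left; exact: sysR1 sys.
- by move=> E p [SE _ _]; exact: (sys_fin sys SE).
- move=> g E p [SE hit full]; split; first exact: (sys_shift sys).
    move=> h; have [[i Ci]|few] := hit (g^-1 ** h).
      by left; exists i; apply/placed_shift; rewrite gmul_assoc.
    right; apply: leq_trans few; apply: subset_leq_card; apply/subsetP => i.
    by rewrite !inE => /asboolP/meets_shift Ti; apply/asboolP; rewrite -gmul_assoc.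
  move=> h; have [[w [Ww Cw]]|[w [Ww Tw]]] := full (g^-1 ** h).
    left; exists w; split=> // i; apply/placed_shift; rewrite !gmul_assoc; exact: Cw.
  right; exists w; split=> // i /meets_shift; rewrite !gmul_assoc; exact: Tw.
- move=> E p p' [SE hit full] pp'; split; first exact: (sys_agree sys SE).
    move=> h; have [[i Ci]|few] := hit h; last by right.
    by left; exists i; apply: placed_agree pp' Ci.
  move=> h; have [[w [Ww Cw]]|] := full h; last by right.
  by left; exists w; split=> // i; apply: placed_agree pp' (Cw i).
- move=> F I E p finF SE finE sep.
  exact: (step_extension finF SE finE sep).
Qed.

(** Both domains contain the window, so the boundary alternatives fail. Thus p fills some w Q
    completely while p' shows the pattern at one point of that same w Q; this point is c. *)
Lemma step_agreement E p E' p' : step_class E p -> step_class E' p' ->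
  (forall x, pmul W (pmul Qs E0) x -> E x) -> (forall x, pmul W (pmul Qs E0) x -> E' x) ->
  exists c, forall f, E0 f ->
    pmul W (pmul Qs E0) (c ** f) /\ agree_upto n (p (c ** f)) (p' (c ** f)).
Proof.
move=> [_ _ full] [_ hit _] EW E'W.
have in_win w i z : W w -> E0 z -> pmul W (pmul Qs E0) (w ** (q i ** z)).
  by move=> Ww Ez; apply: pmulI => //; apply: pmulI.
have meets_in (A : G -> Prop) w i : W w -> (forall x, pmul W (pmul Qs E0) x -> A x) ->
    meets A (w ** q i).
  move=> Ww AW; exists (w ** q i), (gone G); rewrite gmulr1; split=> //.
  by apply: AW; have := in_win w i _ Ww E01; rewrite gmulr1.
have WW0 w : W0 w -> W w by move=> Ww; exists w, (gone G); rewrite gmulr1.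
have [[w [Ww Cw]]|[w [Ww Tw]]] := full (gone G); last first.
  by case: (Tw i0); rewrite gmul1; apply: meets_in => //; apply: WW0.
have [[i Ci]|few] := hit w; last first.
  (* All 8k sites are met, and 8k > 2k. *)
  move: few; rewrite (_ : [set i | _] = setT) ?cardsT ?card_ord; first by clear -k0; lia.
  by apply/setP => i; rewrite !inE; apply/asboolP; apply: meets_in.
exists (w ** q i) => f Ef; split; first by rewrite gmulA; apply: in_win.
have := Cw i; rewrite gmul1 => /(_ f Ef) [_ a1].
have [_ a2] := Ci f Ef.
by move=> j jn; rewrite a1 // a2.
Qed.

Lemma fin_window : fin (pmul W (pmul Qs E0)).
Proof. by apply: fin_pmul fin_step_net _; apply: fin_pmul. Qed.
End ProximalStep.

Lemma proximal_step (G : Group) n (S : (G -> Prop) -> config G -> Prop) K R (F : G -> Prop) :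
  icc G -> (exists d, d <> gone G) -> system n S K R -> fin F ->
  exists S' K' R' Win, [/\ system n S' K' R', forall E p, S' E p -> S E p, fin Win &
    forall E p E' p', S' E p -> S' E' p' ->
      (forall x, Win x -> E x) -> (forall x, Win x -> E' x) ->
      exists c, forall f, F f ->
        Win (c ** f) /\ agree_upto n (p (c ** f)) (p' (c ** f))].
Proof.
move=> iccG ntG sys finF.
have [E0 [p0 [SE0 FE0]]] := system_cover sys (fin_por finF (fin_psing (gone G))).
have E01 : E0 (gone G) by apply: FE0; right.
pose D := step_dist K R E0.
have finD : fin D := fin_step_dist sys SE0.
have D1 : D (gone G) := step_dist1 sys E01.
have DV x : D x -> D x^-1 by exact: step_distV.
(* Order of choices: kappa depends on [D] alone, k is then at least kappa, and the 8k generic points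
   come last. *)
have [kappa gen] := generic_points iccG ntG finD D1 DV.
have [k [kk k0 hit]] := hitting finD D1 DV kappa.
have [q [spr qgen]] := gen (8 * k).
pose B := step_diff K R E0 q.
have finB : fin B := fin_step_diff sys SE0 q.
(* As w1 is outside B^-1 B, no translate g B contains both 1 and w1. *)
have [w1 w1B] := avoid_finite iccG ntG (fin_pmul (fin_pinv finB) finB).
pose W0 := por (psing (gone G)) (psing w1).
have finW0 : fin W0 by apply: fin_por; exact: fin_psing.
have W01 : W0 (gone G) by left.
have W0av g : exists w, W0 w /\ ~ B (g^-1 ** w).
  have [Bg|nB] := pselect (B g^-1); last by exists (gone G); rewrite gmulr1.
  exists w1; split=> [|Bw]; first by right.
  by apply: w1B; exists g, (g^-1 ** w1); rewrite gmulKV.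
exists (step_class n S K R E0 p0 q W0), (step_sep K E0 q W0), (step_reach K R E0 q W0),
  (pmul (step_net K R E0 q W0) (pmul (fun x => exists i, x = q i) E0)).
split.
- apply: (step_system sys SE0 E01 kk k0 spr qgen _ finW0 W01 W0av) => Al H finAl finH.
  exact: hit.
- by move=> E p [].
- exact: (fin_window sys SE0 q finW0).
- move=> E p E' p' SE SE' EW E'W.
  have [c cP] := step_agreement sys E01 k0 W01 SE SE' EW E'W.
  by exists c => f Ff; apply: cP; apply: FE0; left.
Qed.

(** * Symbolic flows *)

Section SymbolicFlow.
Variables (G : Group) (f : G -> nat).
Hypothesis f_inj : forall a b, f a = f b -> a = b.

Definition agree N (x y : config G) : Prop := forall h j, f h < N -> j < N -> x h j = y h j.

Lemma agree_sym N x y : agree N x y -> agree N y x.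
Proof. by move=> xy h j hN jN; rewrite xy. Qed.
Lemma agree_trans N x y z : agree N x y -> agree N y z -> agree N x z.
Proof. by move=> xy yz h j hN jN; rewrite xy // yz. Qed.
Lemma agree_le M N x y : M <= N -> agree N x y -> agree M x y.
Proof. by move=> MN xy h j hM jM; apply: xy; [apply: leq_trans hM MN|apply: leq_trans jM MN]. Qed.
Lemma agree_eq x y : (forall N, agree N x y) -> x = y.
Proof.
move=> xy; apply/funext => h; apply/funext => j.
by apply: (xy (maxn (f h) j).+1); rewrite ltnS; [exact: leq_maxl|exact: leq_maxr].
Qed.

Lemma fin_initial N : fin (fun h => f h < N).
Proof.
elim: N => [|N [l lP]]; first by exists nil.
have [[h0 h0N]|no] := pselect (exists h, f h = N).
  exists (h0 :: l) => h; rewrite ltnS leq_eqVlt => /predU1P[hN|/lP]; last by right.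
  by left; apply: f_inj; rewrite h0N.
exists l => h; rewrite ltnS leq_eqVlt => /predU1P[hN|/lP //].
by case: no; exists h.
Qed.

Lemma fin_bound (A : G -> Prop) : fin A -> exists N, forall a, A a -> f a < N.
Proof.
move=> [l lP]; suff [N NP] : exists N, forall a, List.In a l -> f a < N.
  by exists N => a /lP /NP.
elim: l {lP} => [|a l [N NP]]; first by exists 0.
exists (maxn (f a).+1 N) => b [<-|/NP bN]; rewrite leq_max ?leqnn //.
by rewrite bN orbT.
Qed.

Lemma shift_mul g h (x : config G) : shift g (shift h x) = shift (g ** h) x.
Proof. by apply/funext => a; rewrite /shift !gnorm. Qed.
Lemma shift1 (x : config G) : shift (gone G) x = x.
Proof. by apply/funext => a; rewrite /shift !gnorm. Qed.

Lemma shift_agree g N : exists M, forall x y, agree M x y -> agree N (shift g x) (shift g y).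
Proof.
have [M MP] := fin_bound (fin_pmul (fin_psing g^-1) (fin_initial N)).
exists (maxn M N) => x y xy h j hN jN; apply: xy; rewrite leq_max.
  by rewrite MP //; apply: pmulI.
by rewrite jN orbT.
Qed.

Lemma finitely_many_cylinders N :
  exists l : list (config G), forall x : config G, exists y, List.In y l /\ agree N x y.
Proof.
have [M [b [binj bP]]] := fin_enum (fin_initial N).
pose code (x : config G) : {ffun 'I_M * 'I_N -> 'I_3} := [ffun u => x (b u.1) (val u.2)].
have /choice [r rP] phi : exists y, (exists x, code x = phi) -> code y = phi.
  have [[x xphi]|no] := pselect (exists x, code x = phi); first by exists x.
  by exists (fun _ _ => ord0) => /no.
exists (List.map r (enum {: {ffun 'I_M * 'I_N -> 'I_3}})) => x.
exists (r (code x)); split.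
  by apply: in_map; exact: In_enum.
move=> h j /bP [i ->] jN; have /ffunP /(_ (i, Ordinal jN)) := rP (code x) (ex_intro _ x erefl).
by rewrite !ffunE.
Qed.

(** Koenig's argument: there are finitely many cylinders of each level, so a cylinder visited
    infinitely often contains one of the next level with the same property. The limit is read off
    along the diagonal. *)
Lemma cluster_point (u : nat -> config G) :
  exists x, forall N k, exists m, k <= m /\ agree N x (u m).
Proof.
pose P N x := forall k, exists m, k <= m /\ agree N x (u m).
have step N x : P N x -> exists x', agree N x x' /\ P N.+1 x'.
  move=> Px; apply: contrapT => no; have [l lP] := finitely_many_cylinders N.+1.
  have [K KP] : exists K, forall r, List.In r l -> agree N x r ->
      forall m, K <= m -> ~ agree N.+1 r (u m).
    elim: l {lP} => [|r l [K KP]]; first by exists 0.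
    have [xr|xr] := pselect (agree N x r); last first.
      by exists K => r' [<- //|]; exact: KP.
    have [k kP] : exists k, forall m, k <= m -> ~ agree N.+1 r (u m).
      apply: contrapT => nok; apply: no; exists r; split=> // k.
      apply: contrapT => nom; apply: nok; exists k => m km rm; apply: nom.
      by exists m.
    exists (maxn k K) => r' [<-|r'l] xr' m; rewrite geq_max => /andP[km Km].
      exact: kP.
    exact: KP.
  have [m [Km xm]] := Px K; have [r [rl mr]] := lP (u m).
  apply: (KP r rl _ m Km); last exact: agree_sym.
  by apply: agree_trans xm _; apply: (agree_le _ mr).
have /choice [g gP] (v : nat * config G) : exists x',
    P v.1 v.2 -> agree v.1 v.2 x' /\ P v.1.+1 x'.
  have [/step [x' H]|no] := pselect (P v.1 v.2); first by exists x'.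
  by exists v.2.
pose xs := fix xs N := if N is N'.+1 then g (N', xs N') else (fun _ _ => ord0).
have Pxs N : P N (xs N).
  elim: N => [k|N IH]; first by exists k; split=> // h j; rewrite ltn0.
  by case: (gP (N, xs N) IH).
have axs N M : N <= M -> agree N (xs N) (xs M).
  elim: M => [|M IH]; first by rewrite leqn0 => /eqP ->.
  rewrite leq_eqVlt ltnS => /predU1P[-> //|NM].
  apply: agree_trans (IH NM) _; apply: (agree_le NM).
  by case: (gP (M, xs M) (Pxs M)).
exists (fun h j => xs (maxn (f h) j).+1 h j) => N k.
have [m [km am]] := Pxs N k; exists m; split=> //.
apply: agree_trans am => h j hN jN.
by apply: axs; rewrite ?gtn_max ?hN // ltnS ?leq_maxl ?leq_maxr.
Qed.

Section Flow.
Variable X : config G -> Prop.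
Hypothesis Xinh : exists x, X x.
Hypothesis Xclosed : forall x, (forall N, exists y, X y /\ agree N x y) -> X x.
Hypothesis Xshift : forall g x, X x -> X (shift g x).
Local Notation TX := {x | X x}.
Local Notation sv := (@proj1_sig _ X).

Lemma subshift_eq (x y : TX) : (forall N, agree N (sv x) (sv y)) -> x = y.
Proof.
case: x y => [x Xx] [y Xy] /= /agree_eq xy.
by move: Xx Xy; rewrite xy => Xx Xy; congr exist; apply: Prop_irrelevance.
Qed.

Definition cylinder_open (U : TX -> Prop) : Prop :=
  forall x, U x -> exists N, forall y, agree N (sv x) (sv y) -> U y.

Lemma cylinder_open_full : cylinder_open (fun=> True).
Proof. by move=> x _; exists 0. Qed.
Lemma cylinder_open_inter U V : cylinder_open U -> cylinder_open V ->
  cylinder_open (fun x => U x /\ V x).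
Proof.
move=> oU oV x [/oU [M MU] /oV [N NV]]; exists (maxn M N) => y xy.
by split; [apply: MU|apply: NV]; apply: (agree_le _ xy); rewrite leq_max leqnn ?orbT.
Qed.
Lemma cylinder_open_union (F : (TX -> Prop) -> Prop) :
  (forall U, F U -> cylinder_open U) -> cylinder_open (fun x => exists U, F U /\ U x).
Proof.
move=> oF x [U [FU Ux]]; have [N NU] := oF U FU x Ux.
by exists N => y /NU Uy; exists U.
Qed.
Definition cylinder_topology : topology TX :=
  @Build_topology TX cylinder_open cylinder_open_full cylinder_open_inter cylinder_open_union.
Local Notation T := cylinder_topology.

Lemma open_cylinder N (x : TX) : is_open T (fun y => agree N (sv x) (sv y)).
Proof. by move=> y xy; exists N => z yz; apply: agree_trans xy yz. Qed.

(** A Lebesgue number argument: if no level N works for all points, a cluster point of the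
    counterexamples contradicts the openness of a member covering it. The finitely many cylinders of
    level N then give the subcover. *)
Lemma compact_subshift : compact T.
Proof.
move=> F oF cF.
have [N NP] : exists N, forall x : TX, exists U, F U /\ forall y, agree N (sv x) (sv y) -> U y.
  apply: contrapT => no.
  have /choice [u uP] N : exists x : TX, forall U, F U -> ~ forall y, agree N (sv x) (sv y) -> U y.
    apply: contrapT => noN; apply: no; exists N => x; apply: contrapT => noU; apply: noN.
    by exists x => U FU xU; apply: noU; exists U.
  have [x xP] := cluster_point (fun m => sv (u m)).
  have Xx : X x.
    apply: Xclosed => N; have [m [_ am]] := xP N 0.
    by exists (sv (u m)); split=> //; exact: proj2_sig.
  have [U [FU Ux]] := cF (exist _ x Xx); have [N NU] := oF U FU _ Ux.
  have [m [Nm am]] := xP N N; apply: (uP m U FU) => y my.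
  by apply: NU; apply: agree_trans am _; apply: (agree_le _ my).
have [l lP] := finitely_many_cylinders N.
have [lu [luF luP]] : exists lu : list (TX -> Prop), (forall U, List.In U lu -> F U) /\
    forall r (z : TX), List.In r l -> agree N r (sv z) -> exists U, List.In U lu /\ U z.
  elim: l {lP} => [|r l [lu [luF luP]]]; first by exists nil.
  have [[z rz]|no] := pselect (exists z : TX, agree N r (sv z)); last first.
    exists lu; split=> // r' z [<-|]; last exact: luP.
    by move=> rz; case: no; exists z.
  have [U [FU zU]] := NP z; exists (U :: lu); split=> [V [<- //|]|r' z' [<- rz'|]].
  - exact: luF.
  - exists U; split; first by left.
    by apply: zU; apply: agree_trans rz'; exact: agree_sym.
  - by move=> r'l /(luP _ _ r'l) [V [Vlu Vz]]; exists V; split=> //; right.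
exists lu; split=> // x; have [r [rl xr]] := lP (sv x).
by apply: (luP r x rl); exact: agree_sym.
Qed.

Lemma hausdorff_subshift : hausdorff T.
Proof.
move=> x y xy.
have [N nN] : exists N, ~ agree N (sv x) (sv y).
  apply: contrapT => no; apply: xy; apply: subshift_eq => N.
  by apply: contrapT => nN; apply: no; exists N.
exists (fun z => agree N (sv x) (sv z)), (fun z => agree N (sv y) (sv z)).
split; first exact: open_cylinder; split; first exact: open_cylinder.
split=> //; split=> // z xz yz; apply: nN.
by apply: agree_trans xz _; exact: agree_sym.
Qed.

Lemma metrizable_subshift : metrizable T.
Proof.
have Rinv_le (M N : nat) : N <= M -> (/ INR M.+1 <= / INR N.+1)%Re.
  move=> NM; apply: Rinv_le_contravar; first by apply: lt_0_INR; lia.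
  by apply: le_INR; lia.
have Rinv_pos (N : nat) : (0 < / INR N.+1)%Re.
  by apply/Rinv_0_lt_compat/lt_0_INR; lia.
(* The distance is 1/(m+1) for the least m at which agreement fails, and 0 if there is none; the
   cylinders are then exactly the balls of radius 1/(N+1). *)
have /choice [d dP] (u : TX * TX) : exists r : R, [/\ (0 <= r)%Re,
    (forall N, agree N (sv u.1) (sv u.2) <-> (r < / INR N.+1)%Re) &
    r = 0%Re \/ exists2 m, r = (/ INR m.+1)%Re & ~ agree m (sv u.1) (sv u.2)].
  have [same|diff] := pselect (forall N, agree N (sv u.1) (sv u.2)).
    exists 0%Re; split; [lra| |by left] => N.
    by split=> // _; exact: Rinv_pos.
  have ex : exists N, `[< ~ agree N (sv u.1) (sv u.2) >].
    apply: contrapT => no; apply: diff => N; apply: contrapT => nN.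
    by apply: no; exists N; apply/asboolP.
  have [m /asboolP nm mmin] := ex_minnP ex.
  exists (/ INR m.+1)%Re; split; first exact/Rlt_le/Rinv_pos.
    move=> N; split=> [aN|lt].
      apply: Rinv_lt_contravar; last first.
        apply: lt_INR; apply/ltP; rewrite ltnS ltnNge; apply/negP => mN.
        by apply: nm; apply: (agree_le mN).
      by apply: Rmult_lt_0_compat; apply: lt_0_INR; lia.
    apply: contrapT => nN; have mN : m <= N by apply: mmin; apply/asboolP.
    by have := Rinv_le _ _ mN; lra.
  by right; exists m.
exists (fun x y => d (x, y)); split; last first.
  move=> U; split=> [oU x Ux|oU x Ux].
    have [N NU] := oU x Ux; exists (/ INR N.+1)%Re; split=> // y dxy.
    by apply: NU; have [_ agr _] := dP (x, y); apply/agr.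
  have [eps [eps0 epsU]] := oU x Ux.
  have [N [Neps N0]] := archimed_cor1 _ eps0.
  exists N.-1 => y xy; apply: epsU; have [_ agr _] := dP (x, y).
  apply: Rlt_trans Neps; have := proj1 (agr N.-1) xy.
  by rewrite prednK //; apply/ltP.
have dsmall x y m : ~ agree m (sv x) (sv y) -> (/ INR m.+1 <= d (x, y))%Re.
  move=> nm; have [_ /(_ m) agr _] := dP (x, y).
  by apply: Rnot_lt_le => /agr.
split=> [x y|]; first by case: (dP (x, y)).
split=> [x y|].
  have [d0 agr val] := dP (x, y); split=> [dxy|xy].
    by apply: subshift_eq => N; apply/agr; rewrite dxy.
  by case: val => [//|[m _ nm]]; case: nm; rewrite /= xy.
have dsym x y : (d (x, y) <= d (y, x))%Re.
  have [_ _ [->|[m -> nm]]] := dP (x, y); first by case: (dP (y, x)).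
  by apply: dsmall => ym; apply: nm; apply: agree_sym.
split=> [x y|x y z]; first by apply: Rle_antisym.
have [dxy _ _] := dP (x, y); have [dyz _ _] := dP (y, z).
have [_ _ [->|[m -> nm]]] := dP (x, z); first by lra.
have [xy|nxy] := pselect (agree m (sv x) (sv y)); last first.
  apply: Rle_trans (dsmall _ _ _ nxy) _; rewrite -{1}(Rplus_0_r (d (x, y))); exact: Rplus_le_compat_l.
have nyz : ~ agree m (sv y) (sv z) by move=> yz; apply: nm; apply: agree_trans xy yz.
apply: Rle_trans (dsmall _ _ _ nyz) _; rewrite -{1}(Rplus_0_l (d (y, z))); exact: Rplus_le_compat_r.
Qed.

Definition shift_act (g : G) (x : TX) : TX := exist _ (shift g (sv x)) (Xshift g (proj2_sig x)).

Lemma shift_act_continuous g : continuous T (shift_act g).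
Proof.
move=> U oU x /oU [N NU]; have [M MP] := shift_agree g N.
by exists M => y xy; apply: NU; apply: MP.
Qed.

Lemma sv_inj (x y : TX) : sv x = sv y -> x = y.
Proof. by move=> xy; apply: subshift_eq => N; rewrite xy. Qed.

Lemma shift_flow : is_G_flow G TX T shift_act.
Proof.
have actM g h x : shift_act (g ** h) x = shift_act g (shift_act h x).
  by apply: sv_inj; rewrite /= shift_mul.
have act1 x : shift_act (gone G) x = x by apply: sv_inj; rewrite /= shift1.
split; first by have [x Xx] := Xinh; split; exists x.
split; first exact: compact_subshift.
split; first exact: hausdorff_subshift.
do 2!split=> //; move=> g; split; first exact: shift_act_continuous.
exists (shift_act g^-1); split; first exact: shift_act_continuous.
by split=> x; rewrite -actM !gnorm.
Qed.

(** Translates c_m x and c_m y agree up to level m, so along a subsequence where the first converges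
    the second has the same limit. *)
Lemma proximal_subshift :
  (forall x y, X x -> X y -> forall N, exists c, forall h j, f h < N -> j < N ->
    x (c ** h) j = y (c ** h) j) -> proximal G TX T shift_act.
Proof.
move=> Xprox x y.
have /choice [c cP] N : exists c, agree N (shift c (sv x)) (shift c (sv y)).
  have [c cP] := Xprox _ _ (proj2_sig x) (proj2_sig y) N; exists c^-1 => h j hN jN.
  by rewrite /shift ginvK cP.
have [z zP] := cluster_point (fun m => shift (c m) (sv x)).
have Xz : X z.
  apply: Xclosed => N; have [m [_ am]] := zP N 0.
  by exists (shift (c m) (sv x)); split=> //; apply: Xshift; exact: proj2_sig.
have /choice [m mP] N : exists m, N <= m /\ agree N z (shift (c m) (sv x)) by exact: zP.
exists (exist _ z Xz), nat, (fun i j => i <= j), (fun N => c (m N)); split.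
  split; first by split; exact: 0.
  split=> //; split=> [i j k ij jk|i j]; first exact: leq_trans ij jk.
  by exists (maxn i j); rewrite leq_maxl leq_maxr.
split=> U oU Uz; have [N NU] := oU _ Uz; exists N => i Ni; apply: NU => /=.
  by have [_ am] := mP i; apply: (agree_le Ni).
have [im am] := mP i; apply: (agree_le Ni); apply: agree_trans am _.
by apply: (agree_le im).
Qed.
End Flow.
End SymbolicFlow.

Lemma symbolic_flow_exists (G : Group) (f : G -> nat) (X : config G -> Prop) :
  (forall a b, f a = f b -> a = b) ->
  (exists x, X x) ->
  (forall x, (forall N, exists y, X y /\ agree f N x y) -> X x) ->
  (forall g x, X x -> X (shift g x)) ->
  (forall g x, X x -> shift g x = x -> g = gone G) ->
  (forall x y, X x -> X y -> forall N, exists c, forall h j, f h < N -> j < N ->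
    x (c ** h) j = y (c ** h) j) ->
  exists (Y : Type) (T : topology Y) (act : G -> Y -> Y),
    is_G_flow G Y T act /\ free_action G Y act /\ metrizable T /\ proximal G Y T act.
Proof.
move=> f_inj Xinh Xclosed Xshift Xfree Xprox.
exists {x | X x}, (cylinder_topology f X), (shift_act Xshift); split.
  exact: shift_flow.
split; first by move=> g [x Xx] /(congr1 (@proj1_sig _ X)) /= /(Xfree g x Xx).
split; first exact: metrizable_subshift.
exact: proximal_subshift.
Qed.

(** * The limit subshift of a sequence of classes *)

Lemma fin_bigunion (G : Group) (A : nat -> G -> Prop) N :
  (forall n, fin (A n)) -> fin (fun x => exists n, n < N /\ A n x).
Proof.
move=> finA; elim: N => [|N IH]; first by exists nil => x [n []].
apply: fin_sub (fin_por IH (finA N)) => x [n [nN Anx]].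
have [nE|nN'] := eqVneq n N; first by right; rewrite -nE.
by left; exists n; split=> //; rewrite ltn_neqAle nN' -ltnS.
Qed.

Section Limit.
Variables (G : Group) (f : G -> nat).
Hypothesis f_inj : forall a b, f a = f b -> a = b.
Variable s : nat -> G.
Hypothesis sP : forall g, s (f g) = g.
Variables (S : nat -> (G -> Prop) -> config G -> Prop) (K R : nat -> G -> Prop).
Hypothesis S_system : forall n, system n (S n) (K n) (R n).
Hypothesis S_succ : forall n E p, S n.+1 E p -> S n E p /\ proper_at n (s n) E p.
Variable Win : nat -> G -> Prop.
Hypothesis finWin : forall n, fin (Win n).
Hypothesis Win1 : forall n, Win n (gone G).
Hypothesis Wins : forall n, Win n (s n).
Hypothesis S_agree : forall n E p E' p', S n.+1 E p -> S n.+1 E' p' ->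
  (forall x, Win n x -> E x) -> (forall x, Win n x -> E' x) ->
  exists c, forall h, f h < n ->
    Win n (c ** h) /\ agree_upto n.+1 (p (c ** h)) (p' (c ** h)).

(** Class membership is required of a pattern, not of x itself, and only a finite window is
    compared; the condition is therefore closed. The index is n+1 because coordinate n is controlled
    from class n+1 on. *)
Definition good n (x : config G) : Prop := exists E p, S n.+1 E p /\
  forall w, Win n w -> E w /\ agree_upto n.+1 (p w) (x w).
Definition limit_subshift (x : config G) : Prop := forall n g, good n (shift g x).

Lemma good_agree n g : exists N, forall x y, agree f N x y ->
  good n (shift g y) -> good n (shift g x).
Proof.
have [N NP] := fin_bound f (finWin n); have [M MP] := shift_agree f_inj g (maxn N n.+1).
exists M => x y xy [E [p [SE Ep]]]; exists E, p; split=> // w Ww.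
have [Ew agr] := Ep w Ww; split=> // j jn.
by rewrite agr // (MP _ _ xy) // leq_max ?jn ?orbT // NP.
Qed.

Lemma S_le m n E p : m <= n -> S n E p -> S m E p.
Proof.
elim: n => [|n IH]; first by rewrite leqn0 => /eqP ->.
rewrite leq_eqVlt ltnS => /predU1P[-> //|mn] /S_succ[SE _]; exact: IH.
Qed.

(** A pattern of class N covering g^-1 [Win n] for all n and [f g] below N meets these conditions
    once shifted by g; a cluster point as N grows meets all of them. *)
Lemma limit_subshift_inh : exists x, limit_subshift x.
Proof.
pose F N := pmul (pinv (fun h => f h < N)) (fun w => exists n, n < N /\ Win n w).
have finF N : fin (F N).
  by apply: fin_pmul; [apply/fin_pinv/fin_initial|exact: fin_bigunion].
have /choice [u uP] N : exists p, exists2 E, S N E p & forall x, F N x -> E x.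
  have [E [p [SE FE]]] := system_cover (S_system N) (finF N).
  by exists p, E.
have [x xP] := cluster_point f_inj u; exists x => n g.
have [N NP] := good_agree n g.
have [m [km am]] := xP N (maxn (f g) n).+1.
apply: NP am _; have [E SE FE] := uP m.
exists (shift g E), (shift g (u m)); split.
  apply: (sys_shift (S_system n.+1)); apply: S_le SE.
  by apply: leq_trans km; rewrite ltnS leq_maxr.
move=> w Ww; split=> //; apply: FE; apply: pmulI.
  by rewrite /pinv ginvK; apply: leq_trans km; rewrite ltnS leq_maxl.
by exists n; split=> //; apply: leq_trans km; rewrite ltnS leq_maxr.
Qed.

Lemma limit_subshift_closed x :
  (forall N, exists y, limit_subshift y /\ agree f N x y) -> limit_subshift x.
Proof.
move=> H n g; have [N NP] := good_agree n g.
have [y [Xy xy]] := H N; exact: (NP x y xy (Xy n g)).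
Qed.

Lemma limit_subshift_shift g x : limit_subshift x -> limit_subshift (shift g x).
Proof. by move=> Xx n h; rewrite shift_mul; apply: Xx. Qed.

(** At n = f g^-1 the colouring separates 1 from g^-1, whereas shift g x = x gives both the same
    value. *)
Lemma limit_subshift_free g x : limit_subshift x -> shift g x = x -> g = gone G.
Proof.
move=> Xx gx; apply: contrapT => g1; pose n := f g^-1.
have [E [p [/S_succ[_ proper] Ep]]] := Xx n (gone G).
rewrite shift1 in Ep; rewrite sP in proper.
have Wg : Win n g^-1 by rewrite -(sP g^-1); exact: Wins.
have [E1 a1] := Ep _ (Win1 n); have [Eg ag] := Ep _ Wg.
apply: (proper _ _ E1); rewrite ?gmul1 //.
  by move=> gV; apply: g1; rewrite -(ginvK g) gV ginv1.
rewrite (a1 n) // (ag n) // -{1}gx /shift.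
by rewrite gmulr1.
Qed.

Lemma limit_subshift_proximal x y : limit_subshift x -> limit_subshift y ->
  forall N, exists c, forall h j, f h < N -> j < N -> x (c ** h) j = y (c ** h) j.
Proof.
move=> Xx Xy N; have := Xx N (gone G); have := Xy N (gone G); rewrite !shift1.
move=> [E' [p' [SE' Ep']]] [E [p [SE Ep]]].
have [c cP] := S_agree SE SE' (fun w Ww => proj1 (Ep w Ww)) (fun w Ww => proj1 (Ep' w Ww)).
exists c => h j hN jN; have [Wc a] := cP h hN.
have jN1 : j < N.+1 by apply: ltnW.
have [_ ax] := Ep _ Wc; have [_ ay] := Ep' _ Wc.
by rewrite -ax // a // ay.
Qed.
End Limit.

Theorem theorem1p5 :
  forall G : Group, countable_group G -> icc G ->
    exists (X : Type) (T : topology X) (act : G -> X -> X),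
      is_G_flow G X T act /\ free_action G X act /\
      metrizable T /\ proximal G X T act.
Proof.
move=> G [f f_inj] iccG.
have [ntG|trivG] := pselect (exists d, d <> gone G); last first.
  (* The trivial group is icc as well; a single constant configuration serves as its flow. *)
  have all1 (g : G) : g = gone G by apply: contrapT => g1; apply: trivG; exists g.
  apply: (@symbolic_flow_exists G f (fun x => x = fun _ _ => ord0) f_inj).
  - by exists (fun _ _ => ord0).
  - move=> x xP; apply: (agree_eq (f := f)) => N.
    by have [y [-> xy]] := xP N.
  - by move=> g x ->.
  - by move=> g x _ _; exact: all1.
  - by move=> x y -> -> N; exists (gone G).
have /choice [s sP] n : exists g, forall h, f h = n -> h = g.
  have [[g <-]|no] := pselect (exists g, f g = n).
    by exists g => h /f_inj.
  by exists (gone G) => h hn; case: no; exists h.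
pose class := ((G -> Prop) -> config G -> Prop)%type.
pose sys n (t : class * ((G -> Prop) * (G -> Prop))) := system n t.1 t.2.1 t.2.2.
(* Stage n adds the colouring for [s n], then forces agreement on the points enumerated before n; a
   triple that is no system gets itself as default successor. *)
have /choice [next nextP] (u : nat * (class * ((G -> Prop) * (G -> Prop)))) :
    exists t', sys u.1 u.2 -> [/\ sys u.1.+1 t',
      forall E p, t'.1 E p -> u.2.1 E p /\ proper_at u.1 (s u.1) E p &
      exists Win, fin Win /\ forall E p E' p', t'.1 E p -> t'.1 E' p' ->
        (forall x, Win x -> E x) -> (forall x, Win x -> E' x) ->
        exists c, forall h, f h < u.1 ->
          Win (c ** h) /\ agree_upto u.1.+1 (p (c ** h)) (p' (c ** h))].
  case: u => n [S [K R]]; have [sysS|no] := pselect (sys n (S, (K, R))); last first.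
    by exists (S, (K, R)).
  have [S' [K' [R' [Win [sysS' SS' finWin agr]]]]] :=
    proximal_step iccG ntG (add_coordinate (s n) sysS) (fin_initial f_inj n).
  by exists (S', (K', R')) => _; split=> //; exists Win.
pose t := fix t n := if n is n'.+1 then next (n', t n') else
  ((fun E _ => fin E) : class, (psing (gone G), psing (gone G))).
have tsys n : sys n (t n).
  by elim: n => [|n IH]; [exact: base_system|case: (nextP (n, t n) IH)].
have /choice [Win WinP] n : exists Win, fin Win /\ forall E p E' p', (t n.+1).1 E p -> (t n.+1).1 E' p' ->
    (forall x, Win x -> E x) -> (forall x, Win x -> E' x) ->
    exists c, forall h, f h < n ->
      Win (c ** h) /\ agree_upto n.+1 (p (c ** h)) (p' (c ** h)).
  by case: (nextP (n, t n) (tsys n)).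
(* Freeness compares the values at 1 and at [s n], so both must belong to the window. *)
pose Win' n := por (Win n) (por (psing (gone G)) (psing (s n))).
have finW n : fin (Win' n).
  by apply: fin_por (proj1 (WinP n)) _; apply: fin_por; exact: fin_psing.
have W1 n : Win' n (gone G) by right; left.
have Ws n : Win' n (s n) by right; right.
have sf g : s (f g) = g by symmetry; apply: sP.
have succ n E p : (t n.+1).1 E p -> (t n).1 E p /\ proper_at n (s n) E p.
  by case: (nextP (n, t n) (tsys n)) => _ + _; apply.
have agr n E p E' p' : (t n.+1).1 E p -> (t n.+1).1 E' p' ->
    (forall x, Win' n x -> E x) -> (forall x, Win' n x -> E' x) ->
    exists c, forall h, f h < n ->
      Win' n (c ** h) /\ agree_upto n.+1 (p (c ** h)) (p' (c ** h)).
  move=> SE SE' WE WE'; have [_ /(_ E p E' p' SE SE')] := WinP n.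
  case=> [x Wx|x Wx|c cP]; [by apply: WE; left|by apply: WE'; left|].
  by exists c => h /cP[Wc a]; split=> //; left.
apply: (@symbolic_flow_exists G f (limit_subshift (fun n => (t n).1) Win') f_inj).
- exact: (limit_subshift_inh f_inj tsys succ finW).
- exact: (limit_subshift_closed f_inj finW).
- exact: limit_subshift_shift.
- exact: (limit_subshift_free sf succ W1 Ws).
- exact: (limit_subshift_proximal agr).
Qed.
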